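(* Up to the dual and the inverse symmetries, there are seven types of Wada-type representations, namely those defined by the following pairs $(W,V)$: (5) $(x,y)$; (6) $(y,x^{-1})$; (7) $(y,y^{-m}xy^{m})$, $m\in\mathbb{Z}$; (8) $(y,yx^{-1}y)$; (9) $(y^{-1},x^{-1})$; (10) $(y^{-1},yxy)$; (11) $(xy^{-1}x^{-1},xy^{2})$. That is, a pair $(W,V)$ of reduced words on $\{x^{\pm1},y^{\pm1}\}$ defines a Wada-type representation if and only if it is obtained from a pair in this list by applying finitely many (possibly zero) times the operations of passing to the dual and passing to the inverse.
   Context: Let $F_2$ be the free group on $x,y$, and $F_n$ the free group on $x_1,\dots,x_n$. For reduced words $W=W(x,y)$, $V=V(x,y)$ on $\{x^{\pm1},y^{\pm1}\}$ let $\tau_{W,V}:F_2\to F_2$ be the homomorphism $x\mapsto W(x,y)$, $y\mapsto V(x,y)$. Suppose $\tau_{W,V}$ is an automorphism. For $1\le i\le n-1$ let $\tau_i\in\mathrm{Aut}(F_n)$ be given by $\tau_i(x_i)=W(x_i,x_{i+1})$, $\tau_i(x_{i+1})=V(x_i,x_{i+1})$ and $\tau_i(x_j)=x_j$ for $j\ne i,i+1$. Let $B_n$ be the braid group on $n$ strands with its standard generators $\sigma_1,\dots,\sigma_{n-1}$; groups act from the left. A Wada-type representation is a homomorphism $\rho:B_n\to\mathrm{Aut}(F_n)$ with $\rho(\sigma_i)=\tau_i$ for all $i$, for some automorphism $\tau_{W,V}$. The pair $(W,V)$ defines a Wada-type representation if $\tau_{W,V}$ is an automorphism and $\sigma_i\mapsto\tau_i$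 gives a homomorphism $B_n\to\mathrm{Aut}(F_n)$ for all $n$; equivalently, $\tau_{W,V}$ is an automorphism and $\tau_1\tau_2\tau_1=\tau_2\tau_1\tau_2$ in $\mathrm{Aut}(F_3)$. The dual of $(W,V)$ is $(\overline{W},\overline{V})$ with $\overline{W}(x,y)=V(y,x)$ and $\overline{V}(x,y)=W(y,x)$. When $\tau_{W,V}$ is an automorphism, the inverse of $(W,V)$ is the pair of reduced words $(W^{r},V^{r})$ with $\tau_{W,V}^{-1}=\tau_{W^{r},V^{r}}$. Both operations send pairs defining Wada-type representations to pairs defining Wada-type representations. *)

(* Defs.v *)
From HB Require Import structures.
From mathcomp Require Import all_boot all_algebra.
From mathcomp Require Import boolp.

Set Implicit Arguments.
Unset Strict Implicit.
Unset Printing Implicit Defensive.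

Local Open Scope quotient_scope.
Local Open Scope group_scope.

(* Free groups, as reduced words.  The letter (a, false) stands for the       *)
(* generator a, and (a, true) for its inverse.                                *)

Section FreeGroup.
Variable T : choiceType.
Implicit Types (l : T * bool) (u v w : seq (T * bool)).

Definition linv l : T * bool := (l.1, ~~ l.2).

Definition reduced w : bool := sorted [rel l m | m != linv l] w.

Definition cons_red l w :=
  if w is m :: w' then if m == linv l then w' else l :: w else [:: l].

Definition reduce w := foldr cons_red [::] w.

Lemma linvK : involutive linv.
Proof. by case=> a b; rewrite /linv /= negbK. Qed.

Lemma eq_linv l m : (m == linv l) = (l == linv m).
Proof. by apply/eqP/eqP=> ->; rewrite linvK. Qed.

Lemma cons_red_reduced l w : reduced w -> reduced (cons_red l w).
Proof.
case: w => [//|m w] /=; case: ifP => [_|/negbT ml /=]; last by rewrite ml.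
by apply: path_sorted.
Qed.

Lemma foldr_reduced u w : reduced w -> reduced (foldr cons_red w u).
Proof. by move=> rw; elim: u => //= l u; apply: cons_red_reduced. Qed.

Lemma reduce_reduced w : reduced (reduce w).
Proof. exact: foldr_reduced. Qed.

Lemma reduce_id w : reduced w -> reduce w = w.
Proof.
elim: w => //= l w IHw rw; rewrite IHw; last exact: path_sorted rw.
by case: w rw {IHw} => //= m w /andP[/negbTE->].
Qed.

Lemma cons_redK l w : reduced w -> cons_red l (cons_red (linv l) w) = w.
Proof.
case: w => [_|m w] /=; first by rewrite eqxx.
rewrite linvK; case: eqP => [->|_]; last by rewrite /= eqxx.
by case: w => //= k w /andP[/negbTE->].
Qed.

Lemma foldr_cons_red l u w : reduced w ->
  foldr cons_red w (cons_red l u) = cons_red l (foldr cons_red w u).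
Proof.
move=> rw; case: u => //= m u; case: eqP => //= ->.
by rewrite cons_redK // foldr_reduced.
Qed.

Lemma foldr_reduce u w : reduced w ->
  foldr cons_red w (reduce u) = foldr cons_red w u.
Proof. by move=> rw; elim: u => //= l u <-; rewrite foldr_cons_red. Qed.

Lemma reduce_cat u v : reduce (u ++ v) = foldr cons_red (reduce v) u.
Proof. by rewrite /reduce foldr_cat. Qed.

Record free := Free { fword : seq (T * bool); _ : reduced fword }.
HB.instance Definition _ := [isSub for fword].
HB.instance Definition _ := [Choice of free by <:].

Definition fone := @Free [::] isT.
Definition fmul (u v : free) := Free (reduce_reduced (fword u ++ fword v)).
Definition finv (u : free) := Free (reduce_reduced (rev (map linv (fword u)))).

Lemma fmulA : associative fmul.
Proof.
move=> [u ru] [v rv] [w rw]; apply: val_inj => /=.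
rewrite !reduce_cat (reduce_id rw) (reduce_id rv).
rewrite (reduce_id (foldr_reduced _ rw)).
rewrite -{2}(reduce_id rv) -reduce_cat foldr_reduce //.
by rewrite foldr_cat.
Qed.

Lemma fmul1 : left_id fone fmul.
Proof. by move=> [u ru]; apply: val_inj; rewrite /= reduce_id. Qed.

Lemma fmulr1 : right_id fone fmul.
Proof. by move=> [u ru]; apply: val_inj; rewrite /= cats0 reduce_id. Qed.

Lemma foldr_rev_linv u w : reduced w ->
  foldr cons_red (foldr cons_red w u) (rev (map linv u)) = w.
Proof.
move=> rw; elim: u => //= l u IHu; rewrite rev_cons foldr_rcons.
by rewrite -{2}[l]linvK cons_redK // foldr_reduced.
Qed.

Lemma fmulV : left_inverse fone finv fmul.
Proof.
move=> [u ru]; apply: val_inj => /=.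
by rewrite reduce_cat foldr_reduce ?reduce_reduced // foldr_rev_linv.
Qed.

Lemma fmulrV : right_inverse fone finv fmul.
Proof.
move=> [u ru]; apply: val_inj => /=.
rewrite reduce_cat (reduce_id (reduce_reduced _)).
have {2}-> : u = rev (map linv (rev (map linv u))).
  by rewrite map_rev revK mapK //; apply: linvK.
exact: foldr_rev_linv.
Qed.

HB.instance Definition _ :=
  isGroup.Build free fmulA fmul1 fmulr1 fmulV fmulrV.

Definition gen (a : T) : free := @Free [:: (a, false)] isT.

End FreeGroup.

(* Universal property: free_lift f is the morphism sending each gen a to f a. *)
Section FreeLift.
Variables (T : choiceType) (G : groupType) (f : T -> G).

Definition letter_val (l : T * bool) : G :=
  if l.2 then (f l.1)^-1 else f l.1.

Definition free_lift (w : free T) : G :=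
  \prod_(l <- fword w) letter_val l.

Lemma letter_val_linv l : letter_val (linv l) = (letter_val l)^-1.
Proof. by case: l => a []; rewrite /letter_val //= invgK. Qed.

Lemma prod_reduce w :
  \prod_(l <- reduce w) letter_val l = \prod_(l <- w) letter_val l.
Proof.
elim: w => //= l w IHw; rewrite big_cons -IHw.
case: (reduce w) => [|m v] /=; first by rewrite big_cons.
case: eqP => [->|_]; last by rewrite big_cons.
by rewrite big_cons letter_val_linv mulVKg.
Qed.

Lemma free_liftM : {morph free_lift : u v / u * v}.
Proof.
move=> u v; rewrite /free_lift /= prod_reduce big_cat.
by [].
Qed.

HB.instance Definition _ :=
  isMultiplicative.Build (free T) G free_lift free_liftM.

Lemma free_lift_gen a : free_lift (gen a) = f a.
Proof. by rewrite /free_lift big_cons big_nil mulg1. Qed.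

End FreeLift.

(* The quotient of G by the congruence generated by R, i.e. by the normal     *)
(* closure of all a * b^-1 with R a b.                                        *)
Section Quotient.
Variables (G : groupType) (R : G -> G -> Prop).

Inductive cong : G -> G -> Prop :=
| cong_base a b : R a b -> cong a b
| cong_refl a : cong a a
| cong_sym a b : cong a b -> cong b a
| cong_trans b a c : cong a b -> cong b c -> cong a c
| cong_mul a b c d : cong a b -> cong c d -> cong (a * c) (b * d).

Lemma congb_refl : reflexive (fun a b => `[< cong a b >]).
Proof. by move=> a; apply/asboolP; apply: cong_refl. Qed.

Lemma congb_sym : symmetric (fun a b => `[< cong a b >]).
Proof. by move=> a b; apply/asboolP/asboolP; apply: cong_sym. Qed.

Lemma congb_trans : transitive (fun a b => `[< cong a b >]).
Proof.
by move=> b a c /asboolP ab /asboolP bc; apply/asboolP; apply: cong_trans ab bc.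
Qed.

Canonical cong_equiv := EquivRel _ congb_refl congb_sym congb_trans.

Definition group_quot := {eq_quot cong_equiv}.
HB.instance Definition _ := Choice.on group_quot.
HB.instance Definition _ := EqQuotient.on group_quot.

Lemma cong_inv a b : cong a b -> cong a^-1 b^-1.
Proof.
move=> ab; rewrite -[a^-1]mulg1 -(mulgV b) mulgA -[b^-1 in X in cong _ X]mul1g.
apply: cong_mul; last exact: cong_refl.
by rewrite -(mulVg a); apply: cong_mul (cong_refl _) (cong_sym ab).
Qed.

Lemma group_quotP a b : reflect (cong a b) (a == b %[mod group_quot]).
Proof. by rewrite eqmodE; apply: asboolP. Qed.

Lemma repr_cong a : cong (repr (\pi_group_quot a)) a.
Proof. by apply/group_quotP; rewrite reprK. Qed.

Definition qone : group_quot := \pi_group_quot 1.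
Definition qmul (u v : group_quot) : group_quot :=
  \pi_group_quot (repr u * repr v).
Definition qinv (u : group_quot) : group_quot :=
  \pi_group_quot (repr u)^-1.

Lemma pi_mul a b : \pi_group_quot (a * b) = qmul (\pi a) (\pi b).
Proof.
by apply/esym/eqP/group_quotP; apply: cong_mul; apply: repr_cong.
Qed.

Lemma pi_inv a : \pi_group_quot a^-1 = qinv (\pi a).
Proof. by apply/esym/eqP/group_quotP/cong_inv/repr_cong. Qed.

Lemma qmulA : associative qmul.
Proof.
move=> u v w; rewrite -[u]reprK -[v]reprK -[w]reprK.
rewrite -(pi_mul (repr v) (repr w)) -(pi_mul (repr u) (repr v)).
by rewrite -2!pi_mul mulgA.
Qed.

Lemma qmul1 : left_id qone qmul.
Proof. by move=> u; rewrite -[u]reprK -pi_mul mul1g. Qed.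

Lemma qmulr1 : right_id qone qmul.
Proof. by move=> u; rewrite -[u]reprK -pi_mul mulg1. Qed.

Lemma qmulV : left_inverse qone qinv qmul.
Proof. by move=> u; rewrite -[u]reprK -pi_inv -pi_mul mulVg. Qed.

Lemma qmulrV : right_inverse qone qinv qmul.
Proof. by move=> u; rewrite -[u]reprK -pi_inv -pi_mul mulgV. Qed.

HB.instance Definition _ :=
  isGroup.Build group_quot qmulA qmul1 qmulr1 qmulV qmulrV.

End Quotient.

Section Automorphisms.
Variable G : groupType.

Record aut := Aut {
  aut_fun :> G -> G;
  aut_inv : G -> G;
  autM : {morph aut_fun : a b / a * b};
  autK : cancel aut_fun aut_inv;
  autVK : cancel aut_inv aut_fun }.

HB.instance Definition _ := gen_eqMixin aut.
HB.instance Definition _ := gen_choiceMixin aut.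

Lemma aut_eqP (s t : aut) : s =1 t -> s = t.
Proof.
case: s t => [f f' fM fK f'K] [g g' gM gK g'K] /= /funext fg.
move: fM fK f'K; rewrite fg => fM fK f'K {f fg}.
have fg' : f' = g' by apply: funext => a; rewrite -[LHS]gK f'K.
move: fM fK f'K; rewrite fg' => *.
by congr Aut; apply: Prop_irrelevance.
Qed.

Definition aut1 : aut :=
  @Aut id id (fun _ _ => erefl) (fun _ => erefl) (fun _ => erefl).

Lemma aut_compM (s t : aut) : {morph s \o t : a b / a * b}.
Proof. by move=> a b /=; rewrite !autM. Qed.

(* Groups act from the left: (s * t) a = s (t a).                             *)
Definition aut_mul (s t : aut) : aut :=
  Aut (@aut_compM s t) (can_comp (@autK s) (@autK t))
    (can_comp (@autVK t) (@autVK s)).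

Lemma aut_invM (s : aut) : {morph aut_inv s : a b / a * b}.
Proof. by move=> a b; apply: (can_inj (@autK s)); rewrite autM !autVK. Qed.

Definition aut_invg (s : aut) : aut := Aut (@aut_invM s) (@autVK s) (@autK s).

Lemma aut_mulA : associative aut_mul.
Proof. by move=> s t u; apply: aut_eqP. Qed.
Lemma aut_mul1 : left_id aut1 aut_mul.
Proof. by move=> s; apply: aut_eqP. Qed.
Lemma aut_mulr1 : right_id aut1 aut_mul.
Proof. by move=> s; apply: aut_eqP. Qed.
Lemma aut_mulV : left_inverse aut1 aut_invg aut_mul.
Proof. by move=> s; apply: aut_eqP => a /=; rewrite autK. Qed.
Lemma aut_mulrV : right_inverse aut1 aut_invg aut_mul.
Proof. by move=> s; apply: aut_eqP => a /=; rewrite autVK. Qed.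

HB.instance Definition _ :=
  isGroup.Build aut aut_mulA aut_mul1 aut_mulr1 aut_mulV aut_mulrV.

Definition is_automorphism (f : G -> G) : Prop := exists s : aut, s =1 f.

End Automorphisms.

(* F n is free on x_1, ..., x_n, indexed by 'I_n = {0, ..., n-1}.             *)
Definition F (n : nat) : groupType := free 'I_n.

Definition x_ n (i : 'I_n) : F n := gen i.

(* Artin's presentation of the braid group on n strands; the generators       *)
(* sigma_1, ..., sigma_(n-1) are indexed by 'I_n.-1 = {0, ..., n-2}.          *)
Inductive braid_rel n : free 'I_n.-1 -> free 'I_n.-1 -> Prop :=
| braid_far (i j : 'I_n.-1) :
    (i.+1 < j)%N -> braid_rel (gen i * gen j) (gen j * gen i)
| braid_near (i j : 'I_n.-1) :
    j = i.+1 :> nat ->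
    braid_rel (gen i * gen j * gen i) (gen j * gen i * gen j).

Definition B (n : nat) : groupType := group_quot (@braid_rel n).

Definition sigma n (i : 'I_n.-1) : B n :=
  \pi_(group_quot (@braid_rel n)) (gen i).

Lemma lo_proof n (i : 'I_n.-1) : (i < n)%N.
Proof. by apply: leq_trans (ltn_ord i) (leq_pred n). Qed.

Lemma hi_proof n (i : 'I_n.-1) : (i.+1 < n)%N.
Proof. by rewrite -ltn_predRL ltn_ord. Qed.

Definition lo n (i : 'I_n.-1) : 'I_n := Ordinal (lo_proof i).
Definition hi n (i : 'I_n.-1) : 'I_n := Ordinal (hi_proof i).

Definition x : F 2 := x_ ord0.
Definition y : F 2 := x_ ord_max.

(* eval2 W a b is W(a, b). *)
Definition eval2 (G : groupType) (W : F 2) (a b : G) : G :=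
  free_lift (fun k : 'I_2 => if k == ord0 then a else b) W.

Definition tau (W V : F 2) : F 2 -> F 2 := fun u => eval2 u W V.

Definition tau_ (W V : F 2) n (i : 'I_n.-1) : F n -> F n :=
  free_lift (fun k : 'I_n =>
    if k == lo i then eval2 W (x_ (lo i)) (x_ (hi i))
    else if k == hi i then eval2 V (x_ (lo i)) (x_ (hi i))
    else x_ k).

Definition defines_wada (W V : F 2) : Prop :=
  is_automorphism (tau W V) /\
  forall n, exists rho : {multiplicative B n -> aut (F n)},
    forall i : 'I_n.-1, rho (sigma i) =1 tau_ W V i.

Definition dual (p : F 2 * F 2) : F 2 * F 2 :=
  (eval2 p.2 y x, eval2 p.1 y x).

Definition is_inverse (p q : F 2 * F 2) : Prop :=
  cancel (tau p.1 p.2) (tau q.1 q.2) /\ cancel (tau q.1 q.2) (tau p.1 p.2).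

Inductive derived_from (p : F 2 * F 2) : F 2 * F 2 -> Prop :=
| derived_self : derived_from p p
| derived_dual q : derived_from p q -> derived_from p (dual q)
| derived_inverse q r :
    derived_from p q -> is_inverse q r -> derived_from p r.

Definition zexpg (G : groupType) (a : G) (m : int) : G :=
  match m with Posz k => a ^+ k | Negz k => a ^- k.+1 end.

Inductive wada_list : F 2 * F 2 -> Prop :=
| wada_trivial : wada_list (x, y)
| wada_y_Vx : wada_list (y, x^-1)
| wada_conj (m : int) : wada_list (y, zexpg y (- m)%R * x * zexpg y m)
| wada_y_yVxy : wada_list (y, y * x^-1 * y)
| wada_Vy_Vx : wada_list (y^-1, x^-1)
| wada_Vy_yxy : wada_list (y^-1, y * x * y)
| wada_xVyVx_xyy : wada_list (x * y^-1 * x^-1, x * y ^+ 2).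

(* Main.v *)
From HB Require Import structures.
From mathcomp Require Import all_boot all_algebra.
From mathcomp Require Import zify ring boolp.
Require Import Defs.

Set Implicit Arguments.
Unset Strict Implicit.
Unset Printing Implicit Defensive.
Import GRing.Theory Num.Theory.
Local Open Scope group_scope.
Local Open Scope quotient_scope.

(** Why the theorem is true.

    A pair of words [(W, V)] acts on pairs of elements of any group by
    [(a, b) |-> (W(a, b), V(a, b))], and the braid relation for the
    automorphisms [tau_i] is the set-theoretic Yang-Baxter equation for this
    map, in all groups ([defines_wadaP]).  In that form the stability under the
    dual (reverse the triples) and the inverse (invert the maps) is immediate,
    and the seven types are checked by computation in an arbitrary group.

    Conversely, let [X, Y, Z] be the generators of [F 3] and let [t] extend
    [tau] by [Z |-> Z].  The first of the three Yang-Baxter equations says that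
    [t] fixes [u = W(X, W(Y, Z))].  As [t] preserves [Z] and maps words in
    [X, Y] injectively to words in [X, Y], no letter [Z] cancels when [t] is
    applied to a reduced word.  Hence [tau] fixes every piece of [u] that lies
    between two consecutive letters [Z] ([tau_fixed_segment]).

    Suppose that [W] has a power of [x] strictly between two powers of [y].
    Then [W(Y, Z)] and its powers have a power of [Y] strictly between two
    powers of [Z], and such a power of [W(Y, Z)] survives in [u].  So [tau]
    fixes some [y^m] with [m] nonzero, that is [V^m = y^m], and [V = y] because
    roots of generators are unique in free groups; then [W = x] by the second
    equation.  Apart from this trivial pair, [W = x^a y^b x^a'] and, by duality,
    [V = y^d x^c y^d'] with [b] and [c] nonzero ([W_shape]).

    The abelianized equation and the invertibility of [tau] give [b, c = 1] or
    [-1], the vanishing of [a + a'] or of [d + d'], and few values for the other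
    sum.  Now [u] contains a single letter [Z], and both sides of it are explicit
    fixed words of [tau], such as [x^a y^a].  Comparing exponent sums, roots and
    first letters in these identities leaves only the pairs of the list, up to
    the two symmetries ([classify_pos], [classification]). *)

(** * Reduced words *)

Section Words.
Variable T : choiceType.
Implicit Types (l : T * bool) (s p q c g h : seq (T * bool)) (u v w : free T).

Definition winv s := rev (map (@linv T) s).

Definition word_val s : free T := Free (reduce_reduced s).

Lemma linv_neq l : l != linv l.
Proof. by case: l => a b; rewrite /linv xpair_eqE eqxx /=; case: b. Qed.

Lemma fword_reduced w : reduced (fword w). Proof. by case: w. Qed.

Lemma word_valE s : reduced s -> fword (word_val s) = s.
Proof. exact: reduce_id. Qed.

Lemma word_valK w : word_val (fword w) = w.
Proof. by apply: val_inj; apply/reduce_id/fword_reduced. Qed.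

Lemma word_val_cat s q : word_val (s ++ q) = word_val s * word_val q.
Proof.
apply: val_inj; rewrite /= !reduce_cat foldr_reduce ?reduce_reduced //.
by rewrite (reduce_id (reduce_reduced q)).
Qed.

Lemma word_val_nil : word_val [::] = 1. Proof. exact: val_inj. Qed.

Lemma reduced_winv s : reduced s -> reduced (winv s).
Proof.
rewrite /reduced /winv rev_sorted sorted_map; apply: sub_sorted => l m /=.
by rewrite linvK eq_sym.
Qed.

Lemma fwordV u : fword u^-1 = winv (fword u).
Proof. by apply: reduce_id; apply/reduced_winv/fword_reduced. Qed.

Lemma word_val_winv s : word_val (winv s) = (word_val s)^-1.
Proof.
have E : word_val (winv s ++ s) = 1.
  by apply: val_inj; rewrite /= reduce_cat foldr_rev_linv.
by apply: (mulIg (word_val s)); rewrite mulVg -word_val_cat.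
Qed.

Lemma fword_eq1 w : fword w = [::] -> w = 1.
Proof. by move=> E; apply: val_inj. Qed.

(** Reducedness is a condition on adjacent letters, and each adjacent pair lies on
    one side of the overlap [c] or inside it. *)
Lemma reduced_glue s c q :
  c != [::] -> reduced (s ++ c) -> reduced (c ++ q) -> reduced (s ++ c ++ q).
Proof.
case: c => // l c _; case: s => // m s.
rewrite /reduced /= !cat_path /= cat_path.
by move=> /and3P[-> -> ->].
Qed.

Lemma reduced_catl s q : reduced (s ++ q) -> reduced s.
Proof. by case: s => //= l s; rewrite /reduced /= cat_path => /andP[]. Qed.

Lemma reduced_catr s q : reduced (s ++ q) -> reduced q.
Proof. by elim: s => //= l s IHs /path_sorted. Qed.

Lemma reduced_cons l s :
  reduced (l :: s) = (ohead s != Some (linv l)) && reduced s.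
Proof. by case: s. Qed.

Lemma fwordM u v : reduced (fword u ++ fword v) ->
  fword (u * v) = fword u ++ fword v.
Proof. exact: reduce_id. Qed.

End Words.

Lemma expg_conj (G : groupType) (a b : G) n :
  (a * b * a^-1) ^+ n = a * b ^+ n * a^-1.
Proof.
by elim: n => [|n IHn]; rewrite ?mulg1 ?mulgV // !expgS IHn !mulgA mulgVK.
Qed.

Section Hom.
Variables (G H : groupType) (f : G -> H).
Hypothesis fM : {morph f : a b / a * b}.

Lemma hom1 : f 1 = 1.
Proof. by apply: (mulgI (f 1)); rewrite -fM !mulg1. Qed.

Lemma homV a : f a^-1 = (f a)^-1.
Proof. by apply: (mulIg (f a)); rewrite -fM !mulVg hom1. Qed.

Lemma homX a n : f (a ^+ n) = f a ^+ n.
Proof. by elim: n => [|n IHn]; rewrite ?hom1 // !expgS fM IHn. Qed.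

Lemma hom_zexpg a m : f (zexpg a m) = zexpg (f a) m.
Proof. by case: m => n /=; rewrite ?homV homX. Qed.

End Hom.

Section FreeHom.
Variables (T : choiceType) (G : groupType).
Implicit Types (f : free T -> G) (w : free T).

Lemma word_val_prod (s : seq (T * bool)) :
  word_val s = \prod_(l <- s) letter_val (@gen T) l.
Proof.
elim: s => [|l s IHs]; first by rewrite big_nil word_val_nil.
rewrite big_cons -IHs -cat1s word_val_cat; congr (_ * _).
by case: l => a []; apply: val_inj.
Qed.

Lemma hom_word_val f s : {morph f : u v / u * v} ->
  f (word_val s) = \prod_(l <- s) letter_val (f \o @gen T) l.
Proof.
move=> fM; rewrite word_val_prod (big_morph f fM (hom1 fM)).
by apply: eq_bigr => -[a []] _ //=; rewrite /letter_val /= homV.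
Qed.

(** The restriction to the letters of [w] is what makes it possible to identify
    the words avoiding a generator with the words on fewer generators. *)
Lemma hom_eq_in f f' w :
    {morph f : u v / u * v} -> {morph f' : u v / u * v} ->
  (forall l, l \in fword w -> f (gen l.1) = f' (gen l.1)) -> f w = f' w.
Proof.
move=> fM f'M E; rewrite -[w]word_valK !hom_word_val //.
by apply: eq_big_seq => l /E; rewrite /letter_val /= => ->.
Qed.

Lemma hom_eq f f' :
    {morph f : u v / u * v} -> {morph f' : u v / u * v} ->
  (forall a, f (gen a) = f' (gen a)) -> f =1 f'.
Proof. by move=> fM f'M E w; apply: hom_eq_in. Qed.

End FreeHom.

(** * Segments of a word under a homomorphism preserving a letter *)

Section Segments.
Variables (T T' : choiceType) (z : T) (z' : T') (f : free T -> free T').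

Definition avoids (S : choiceType) (a : S) (s : seq (S * bool)) :=
  all (fun l => l.1 != a) s.

Lemma split_letter (S : choiceType) (a : S) s :
  avoids a s \/ exists s0 e s1, avoids a s0 /\ s = s0 ++ (a, e) :: s1.
Proof.
elim: s => [|[b e] s IHs]; first by left.
have [->|ba] := eqVneq b a; first by right; exists [::], e, s.
case: IHs => [zs|[s0 [e0 [s1 [zs0 ->]]]]]; first by left; rewrite /avoids /= ba.
by right; exists ((b, e) :: s0), e0, s1; rewrite /avoids /= ba.
Qed.

Lemma split_letter_inj (S : choiceType) (a : S) s0 e s1 q0 e' q1 :
  avoids a s0 -> avoids a q0 -> s0 ++ (a, e) :: s1 = q0 ++ (a, e') :: q1 ->
  s0 = q0 /\ s1 = q1.
Proof.
elim: s0 q0 => [|l s0 IHs] [|m q0] /=; first by move=> _ _ [].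
- by move=> _ /andP[m_a _] [E _]; rewrite -E eqxx in m_a.
- by move=> /andP[l_a _] _ [E _]; rewrite E eqxx in l_a.
by move=> /andP[_ zs] /andP[_ zq] [-> /(IHs _ zs zq)[-> ->]].
Qed.

Hypothesis fM : {morph f : u v / u * v}.
Hypothesis f_z : f (gen z) = gen z'.
Hypothesis f_avoids :
  forall w, avoids z (fword w) -> avoids z' (fword (f w)).
Hypothesis f_inj : forall w, avoids z (fword w) -> f w = 1 -> w = 1.

Let img s := fword (f (word_val s)).

Lemma f_letter e : f (word_val [:: (z, e)]) = word_val [:: (z', e)].
Proof.
have E (S : choiceType) (a : S) :
    word_val [:: (a, e)] = if e then (gen a)^-1 else gen a.
  by case: e; apply: val_inj.
by rewrite !E -f_z; case: e {E}; rewrite ?homV.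
Qed.

Let img_keeps_z s := reduced s ->
  (forall s0 e s1, avoids z s0 -> s = s0 ++ (z, e) :: s1 ->
     img s = img s0 ++ (z', e) :: img s1) /\
  (forall e, ohead (img s) = Some (z', e) -> ohead s = Some (z, e)).

(** The image of a nonempty segment avoiding [z] is nonempty and avoids [z'], so it
    separates the letters around it just as the segment did, and no letter [z']
    can cancel.  The second component of [img_keeps_z] carries this through the
    induction: an initial letter [z'] only comes from an initial letter [z]. *)
Lemma img_keeps_zP s : img_keeps_z s.
Proof.
have [n] := ubnP (size s); elim: n s => // n IHn s le_sn rs.
have A s0 e s1 : avoids z s0 -> s = s0 ++ (z, e) :: s1 ->
     img s = img s0 ++ (z', e) :: img s1.
  move=> zs0 Es; move: rs; rewrite Es => rs.
  have rs0 := reduced_catl rs; have rzs1 := reduced_catr rs.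
  have rs1 : reduced s1 by move: rzs1; rewrite reduced_cons => /andP[].
  have [|_ B1] := IHn s1 _ rs1.
    by move: le_sn; rewrite Es size_cat /=; lia.
  have zi0 : avoids z' (img s0) by apply: f_avoids; rewrite word_valE.
  rewrite {1}/img -cat1s !word_val_cat !fM f_letter.
  have -> : f (word_val s0) = word_val (img s0) by rewrite word_valK.
  have -> : f (word_val s1) = word_val (img s1) by rewrite word_valK.
  rewrite -!word_val_cat word_valE //; apply: reduced_glue => //; last first.
    rewrite cat1s reduced_cons fword_reduced andbT.
    apply/eqP => /B1 E; move: rzs1; rewrite reduced_cons => /andP[/eqP[]].
    by rewrite E.
  case/lastP E0: (img s0) zi0 (fword_reduced (f (word_val s0))) => [//|t l].
  rewrite /avoids -/(img s0) E0 all_rcons => /andP[lz _] rt.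
  rewrite cats1 -!cats1 -catA; apply: reduced_glue => //.
    by rewrite cats1.
  by rewrite /reduced /= andbT; apply: contra lz => /eqP[->].
split=> // e Ee; case: (split_letter z s) => [zs|[s0 [e' [s1 [zs0 Es]]]]].
  have := f_avoids (w := word_val s); rewrite word_valE // => /(_ zs).
  by rewrite -/(img s); case: (img s) Ee => //= l t [->] /=; rewrite eqxx.
have rs0 : reduced s0 by rewrite Es in rs; apply: reduced_catl rs.
have zi0 : avoids z' (img s0) by apply: f_avoids; rewrite word_valE.
move: Ee; rewrite (A _ _ _ zs0 Es).
case E0: (img s0) zi0 => [|l t] /=; last by move=> /[swap] -[->] /=; rewrite eqxx.
move=> _ [<-]; have : s0 = [::].
  rewrite -(word_valE rs0) (f_inj (w := word_val s0)) ?word_valE //.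
  exact: fword_eq1.
by rewrite Es => ->.
Qed.

Lemma hom_split s0 e s1 : reduced (s0 ++ (z, e) :: s1) -> avoids z s0 ->
  fword (f (word_val (s0 ++ (z, e) :: s1))) =
    fword (f (word_val s0)) ++ (z', e) :: fword (f (word_val s1)).
Proof. by move=> rs zs0; have [A _] := img_keeps_zP rs; apply: A. Qed.

(** This is for substitutions [f] sending [z] to a fresh letter and another letter
    to a long word [U]: the first syllable of [w] in that letter yields a power of
    [U] that occurs in the image without alteration. *)
Lemma hom_first_segment p s q :
    reduced (p ++ s ++ q) -> all (fun l => l.1 == z) p -> avoids z s ->
    (q = [::] \/ exists e q', q = (z, e) :: q') ->
  exists p' q', fword (f (word_val (p ++ s ++ q))) =
    p' ++ fword (f (word_val s)) ++ q'.
Proof.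
elim: p => [|[a e] p IHp] /=; last first.
  move=> /[swap] /andP[/eqP -> zp] rp zs Eq.
  have [p' [q' E]] := IHp (reduced_catr (s := [:: _]) rp) zp zs Eq.
  exists ((z', e) :: p'), q'.
  have E1 : f (word_val [::]) = 1 by rewrite word_val_nil hom1.
  by have /= -> := @hom_split [::] e _ rp isT; rewrite E1 E.
move=> rs _ zs [->|[e [q' Eq]]]; first by exists [::], [::]; rewrite !cats0.
rewrite Eq in rs *; exists [::], ((z', e) :: fword (f (word_val q'))).
exact: hom_split.
Qed.

End Segments.

(** By [hom_split] the letters [z] of a word and of its image match one by one, so
    an equality between the two words can be read off segment by segment. *)
Lemma hom_fixed_segment (T : choiceType) (z : T) (f : free T -> free T)
    (fM : {morph f : u v / u * v}) (f_z : f (gen z) = gen z)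
    (f_avoids : forall w, avoids z (fword w) -> avoids z (fword (f w)))
    (f_inj : forall w, avoids z (fword w) -> f w = 1 -> w = 1)
    p e s e' q :
  reduced (p ++ (z, e) :: s ++ (z, e') :: q) -> avoids z s ->
  f (word_val (p ++ (z, e) :: s ++ (z, e') :: q)) =
    word_val (p ++ (z, e) :: s ++ (z, e') :: q) ->
  f (word_val s) = word_val s.
Proof.
have split1 s0 e0 s1 : reduced (s0 ++ (z, e0) :: s1) -> avoids z s0 ->
    f (word_val (s0 ++ (z, e0) :: s1)) = word_val (s0 ++ (z, e0) :: s1) ->
    f (word_val s0) = word_val s0 /\ f (word_val s1) = word_val s1.
  move=> rs zs0 /(congr1 (@fword T)).
  rewrite (hom_split fM f_z f_avoids f_inj) // word_valE //.
  have rs0 := reduced_catl rs; have rs1 : reduced s1.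
    by have := reduced_catr rs; rewrite reduced_cons => /andP[].
  case/split_letter_inj => //; first by apply: f_avoids; rewrite word_valE.
  by move=> E0 E1; rewrite -{2}E0 -{2}E1 !word_valK.
have [n] := ubnP (size p); elim: n p e => // n IHn p e le_pn rs zs fix_s.
case: (split_letter z p) => [zp|[p0 [e0 [p1 [zp0 Ep]]]]].
  have [_ fix1] := split1 _ _ _ rs zp fix_s.
  have rs1 : reduced (s ++ (z, e') :: q).
    by have := reduced_catr rs; rewrite reduced_cons => /andP[].
  by have [] := split1 _ _ _ rs1 zs fix1.
move: rs fix_s le_pn; rewrite Ep -catA /= => rs fix_s; rewrite size_cat /= => le_pn.
have [_ fix1] := split1 _ _ _ rs zp0 fix_s.
apply: (IHn p1 e) => //; first by lia.
by have := reduced_catr rs; rewrite reduced_cons => /andP[].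
Qed.

(** * Powers in free groups *)

Section Powers.
Variable T : choiceType.
Implicit Types (l : T * bool) (s p q c g h : seq (T * bool)) (w : free T).

Definition wpow c n := flatten (nseq n c).

Lemma word_val_wpow c n : word_val (wpow c n) = word_val c ^+ n.
Proof.
by elim: n => [|n IHn]; rewrite ?word_val_nil // expgS -IHn -word_val_cat.
Qed.

Lemma wpowS c n : wpow c n.+1 = c ++ wpow c n. Proof. by []. Qed.

Lemma cyclic_reduction s : reduced s -> s != [::] ->
  exists g c, [/\ s = g ++ c ++ winv g, c != [::] & reduced (c ++ c)].
Proof.
have [n] := ubnP (size s); elim: n s => // n IHn [//|l s] le_sn rs _.
case/lastP: s le_sn rs => [|t m] le_sn rs.
  exists [::], [:: l]; split=> //; rewrite /reduced /= andbT; exact: linv_neq.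
have [Em|nm] := eqVneq m (linv l); last first.
  exists [::], (l :: rcons t m); split=> //=; first by rewrite cats0.
  have Et : l :: rcons t m = (l :: t) ++ [:: m] by rewrite cats1.
  suff: reduced ((l :: t) ++ [:: m] ++ l :: rcons t m) by rewrite catA -Et.
  apply: reduced_glue; rewrite -?Et //.
  rewrite cat1s reduced_cons rs andbT.
  by apply: contra_neq nm => -[->]; rewrite linvK.
have rt : reduced t.
  by apply: (@reduced_catl _ t [:: m]); rewrite cats1; apply: path_sorted rs.
have [|||g [c [Et nc rc]]] := IHn t => //.
- by move: le_sn; rewrite /= size_rcons; lia.
- by apply: contraTneq rs => ->; rewrite Em /reduced /= eqxx.
exists (l :: g), c; split=> //.
by rewrite Et Em /winv /= rev_cons -!cats1 -!catA.
Qed.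

(** In the power of [g c g^-1], with [c] cyclically reduced, all the junctions
    between [g], the copies of [c] and [g^-1] are already reduced. *)
Lemma pow_shape w : w != 1 -> exists g c,
  c != [::] /\ forall n, fword (w ^+ n.+1) = g ++ wpow c n.+1 ++ winv g.
Proof.
move=> w1; have [|g [c [Ew nc rc]]] := cyclic_reduction (fword_reduced w).
  by apply: contra_neq w1; apply: fword_eq1.
exists g, c; split=> // n.
have rgch : reduced (g ++ c ++ winv g) by rewrite -Ew fword_reduced.
have rch : reduced (wpow c n.+1 ++ winv g).
  elim: n => [|n IHn].
    by rewrite wpowS cats0; apply: reduced_catr rgch.
  by move: IHn; rewrite !wpowS -!catA => IHn; apply: reduced_glue.
have -> : w ^+ n.+1 = word_val (g ++ wpow c n.+1 ++ winv g).
  rewrite -[w]word_valK Ew !word_val_cat word_val_wpow word_val_winv.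
  by rewrite !mulgA expg_conj expgS !mulgA.
rewrite word_valE // wpowS -catA; apply: reduced_glue => //.
  by rewrite catA in rgch; apply: reduced_catl rgch.
by move: rch; rewrite wpowS -catA.
Qed.

Lemma pow_eq1 w n : w ^+ n.+1 = 1 -> w = 1.
Proof.
move=> E; apply/eqP/idPn => /pow_shape[g [c [nc /(_ n)]]].
rewrite E /=; case: g => //=; by case: c nc.
Qed.

Lemma pow_head w n : w != 1 -> ohead (fword (w ^+ n.+1)) = ohead (fword w).
Proof.
move=> /pow_shape[g [c [nc E]]]; rewrite E -[w in RHS]expg1 (E 0%N) !wpowS {E}.
by case: g => //=; case: c nc.
Qed.

Lemma fword_gen_pow (a : T) n : fword (gen a ^+ n) = nseq n (a, false).
Proof.
have R k : reduced (nseq k (a, false)).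
  elim: k => // k IHk; rewrite -[nseq _ _]/(_ :: nseq k _) reduced_cons IHk.
  by case: k {IHk} => // k; rewrite andbT; apply/eqP => -[].
elim: n => // n IHn; rewrite expgS fwordM IHn //; exact: (R n.+1).
Qed.

(** All letters of the power are [a].  Hence [g], which occurs together with its
    inverse, is empty, and the core is a power of [a]. *)
Lemma gen_pow_root (a : T) w n : w ^+ n.+1 = gen a ^+ n.+1 -> w = gen a.
Proof.
move=> E; have w1 : w != 1.
  apply: contra_eq_neq E => ->; rewrite expg1n; apply/eqP.
  by move/(congr1 (@fword T)); rewrite fword_gen_pow.
have [g [c [nc Ew]]] := pow_shape w1.
have all_a : all (pred1 (a, false)) (g ++ wpow c n.+1 ++ winv g).
  by rewrite -Ew E fword_gen_pow; apply/all_pred1P; rewrite size_nseq.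
have g0 : g = [::].
  case: g all_a {Ew} => // l g /allP all_a.
  have /all_a/eqP El : l \in (l :: g) ++ wpow c n.+1 ++ winv (l :: g).
    by rewrite mem_head.
  have /all_a/eqP : linv l \in (l :: g) ++ wpow c n.+1 ++ winv (l :: g).
    by rewrite !mem_cat mem_rev map_f ?orbT // mem_head.
  by rewrite El.
move: all_a (Ew n) (Ew 0%N); rewrite g0 /= !cats0 all_cat => /andP[/all_pred1P Ec _].
rewrite E fword_gen_pow expg1 => /(congr1 size).
rewrite size_nseq size_cat size_flatten /shape map_nseq sumn_nseq -mulnS.
move=> Esz Ew1; apply: val_inj; rewrite /= Ew1 Ec.
by have -> : size c = 1%N by nia.
Qed.

End Powers.

(** * Inner syllables *)

Section Inner.
Variables (T : choiceType) (a b : T).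
Implicit Types (s p q : seq (T * bool)) (w : free T).

Definition inner s := exists p e r e' q,
  [/\ s = p ++ (a, e) :: r ++ (a, e') :: q, r != [::]
    & all (fun l => l.1 == b) r].

Lemma inner_cat p s q : inner s -> inner (p ++ s ++ q).
Proof.
move=> [p1 [e [r [e' [q1 [-> r0 br]]]]]]; exists (p ++ p1), e, r, e', (q1 ++ q).
by split=> //; rewrite -!(catA, cat_cons).
Qed.

Lemma inner_winv s : inner s -> inner (winv s).
Proof.
move=> [p1 [e [r [e' [q1 [-> r0 br]]]]]].
exists (winv q1), (~~ e'), (winv r), (~~ e), (winv p1); split.
- rewrite /winv map_cat /= map_cat /= rev_cat rev_cons rev_cat rev_cons.
  by rewrite -!cats1 -!catA.
- by rewrite -size_eq0 size_rev size_map size_eq0.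
- by rewrite all_rev all_map.
Qed.

Lemma cat_overlap p q p' q' : p ++ q = p' ++ q' -> size p <= size p' ->
  exists m, p' = p ++ m /\ q = m ++ q'.
Proof.
elim: p p' => [|l p IHp] [|l' p'] //=; first by move=> ->; exists [::].
  by move=> ->; exists (l' :: p').
by move=> [-> /IHp E] /E[m [-> ->]]; exists m.
Qed.

Lemma wpowSr c n : @wpow T c n.+1 = wpow c n ++ c.
Proof.
by elim: n => [|n IHn]; rewrite wpowS ?cats0 // {1}IHn catA -wpowS.
Qed.

(** Repeating the cyclic core keeps the beginning and the end of the word; only
    a syllable that contains the whole core changes, and it just gets longer. *)
Lemma inner_expg w n : inner (fword w) -> inner (fword (w ^+ n.+1)).
Proof.
move=> [p [e [r [e' [q [Ew r0 br]]]]]].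
have w1 : w != 1 by apply/eqP => w1; case: p Ew; rewrite w1.
have [g [c [nc Epow]]] := pow_shape w1.
have := Epow 0%N; rewrite expg1 Ew wpowS cats0 => Es; rewrite Epow.
have [le_gp|lt_pg] := leqP (size g) (size p).
  have [m [_ Ech]] := cat_overlap (esym Es) le_gp.
  have im : inner (c ++ winv g) by rewrite Ech; exists m, e, r, e', q.
  by have := inner_cat (g ++ wpow c n) [::] im; rewrite cats0 wpowSr -!catA.
pose p1 := p ++ (a, e) :: r.
have [le_gc|lt_gc] := leqP (size (p1 ++ [:: (a, e')])) (size (g ++ c)).
  have [|m [Egc _]] := @cat_overlap _ q _ (winv g) _ le_gc.
    by rewrite /p1 -!catA /= Es.
  have im : inner (g ++ c) by rewrite Egc /p1 -!catA; exists p, e, r, e', m.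
  by have := inner_cat [::] (wpow c n ++ winv g) im; rewrite wpowS -!catA.
have [||s1 [Eg Er]] := @cat_overlap (p ++ [:: (a, e)]) (r ++ (a, e') :: q)
                        g (c ++ winv g).
- by rewrite -catA /= Es.
- by rewrite size_cat addn1.
have [||s2 [Er2 Eh]] := @cat_overlap (s1 ++ c) (winv g) r ((a, e') :: q).
- by rewrite -catA Er.
- by move: lt_gc; rewrite /p1 Eg !size_cat /=; lia.
move: br; rewrite Er2 !all_cat => /andP[/andP[bs1 bc] bs2].
rewrite Eh Eg -!catA cat1s; exists p, e, (s1 ++ wpow c n.+1 ++ s2), e', q.
split; first by rewrite -!catA.
- by rewrite wpowS; case: (s1) => //; case: (c) nc.
- rewrite 2!all_cat bs1 bs2 andbT andTb; elim: n.+1 => // k IHk.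
  by rewrite wpowS all_cat bc.
Qed.

Lemma inner_zexpg w m : m != 0%R -> inner (fword w) -> inner (fword (zexpg w m)).
Proof.
case: m => [[|n]|n] // _ iw; first exact: inner_expg.
by rewrite /zexpg fwordV; apply/inner_winv/inner_expg.
Qed.

End Inner.

Lemma inner_map (T T' : choiceType) (f : T -> T') a b s :
  inner a b s -> inner (f a) (f b) [seq (f l.1, l.2) | l <- s].
Proof.
move=> [p [e [r [e' [q [-> r0 br]]]]]].
exists [seq (f l.1, l.2) | l <- p], e, [seq (f l.1, l.2) | l <- r], e',
  [seq (f l.1, l.2) | l <- q]; split.
- by rewrite map_cat /= map_cat.
- by case: (r) r0.
- by rewrite all_map; apply: sub_all br => l /= /eqP->.
Qed.

(** After a letter [a], a [b] followed later by another [a] would start an inner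
    syllable; so nothing but [b] can follow the first [b]. *)
Lemma not_inner_tail (T : choiceType) (a b : T) e (s : seq (T * bool)) :
    all (fun l => (l.1 == a) || (l.1 == b)) s -> ~ inner a b ((a, e) :: s) ->
  exists q r, [/\ s = q ++ r, all (fun l => l.1 == a) q
                             & all (fun l => l.1 == b) r].
Proof.
elim: s e => [|[c e1] s IHs] e /=; first by exists [::], [::].
move=> /andP[abc abs] not_in; have [Ec|nca] := eqVneq c a.
  rewrite Ec in not_in *; have [|q [r [-> aq br]]] := IHs e1 abs.
    move=> [p1 [e2 [r [e3 [q [E r0 br]]]]]]; apply: not_in.
    by exists ((a, e) :: p1), e2, r, e3, q; rewrite E.
  by exists ((a, e1) :: q), r; rewrite /= eqxx.
have /eqP Ec : c == b by case/orP: abc nca => // ->.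
rewrite Ec in not_in *.
case: (split_letter a s) => [avs|[r [e2 [q [avr Es]]]]].
  exists [::], ((b, e1) :: s); rewrite /= eqxx; split=> //=.
  by move: abs avs; rewrite /avoids; elim: (s) => //= l t IHt
    /andP[/orP[->//|->] abt] /andP[_ /(IHt abt)].
case: not_in; exists [::], e, ((b, e1) :: r), e2, q; split; rewrite ?Es //=.
rewrite eqxx /=; move: abs avr; rewrite Es all_cat /avoids => /andP[+ _].
by elim: (r) => //= l t IHt /andP[/orP[->//|->] abt] /andP[_ /(IHt abt)].
Qed.

Lemma not_inner (T : choiceType) (a b : T) (s : seq (T * bool)) :
    all (fun l => (l.1 == a) || (l.1 == b)) s -> ~ inner a b s ->
  exists p q r, [/\ s = p ++ q ++ r, all (fun l => l.1 == b) p,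
    all (fun l => l.1 == a) q & all (fun l => l.1 == b) r].
Proof.
elim: s => [|[c e] s IHs] /=; first by exists [::], [::], [::].
move=> /andP[abc abs] not_in; have [Ec|nca] := eqVneq c a.
  rewrite Ec in not_in *; have [q [r [-> aq br]]] := not_inner_tail abs not_in.
  by exists [::], ((a, e) :: q), r; rewrite /= eqxx.
have [|p [q [r [-> bp aq br]]]] := IHs abs.
  move=> [p1 [e2 [r [e3 [q [E r0 br]]]]]]; apply: not_in.
  by exists ((c, e) :: p1), e2, r, e3, q; rewrite E.
exists ((c, e) :: p), q, r; split=> //=.
by rewrite bp andbT; case/orP: abc nca => // ->.
Qed.

(** * Integer powers *)

Section IntegerPowers.
Variable G : groupType.
Implicit Types a b : G.
Local Open Scope ring_scope.

Lemma zexpg_add1 a m : zexpg a (m + 1) = (zexpg a m * a)%g.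
Proof.
case: m => [n|[|n]]; first by rewrite /= addn1 expgSr.
  by rewrite /= expg1 mulVg.
have -> : Negz n.+1 + 1 = Negz n by lia.
by rewrite /= [in RHS]expgS invgM mulgVK.
Qed.

Lemma zexpg_sub1 a m : zexpg a (m - 1) = (zexpg a m * a^-1)%g.
Proof. by rewrite -[m in RHS](subrK 1) zexpg_add1 mulgK. Qed.

Lemma zexpgD a m n : zexpg a (m + n) = (zexpg a m * zexpg a n)%g.
Proof.
elim/int_rect: n => [|n IHn|n IHn].
- by rewrite addr0 mulg1.
- have -> : m + n.+1 = m + n + 1 by lia.
  by rewrite zexpg_add1 IHn -mulgA /= expgSr.
have -> : m + - n.+1%:Z = m + - n%:Z - 1 by lia.
have -> : - n.+1%:Z = - n%:Z - 1 by lia.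
by rewrite !zexpg_sub1 IHn mulgA.
Qed.

Lemma zexpgN a m : zexpg a (- m) = (zexpg a m)^-1%g.
Proof. by apply: (mulIg (zexpg a m)); rewrite mulVg -zexpgD addNr. Qed.

Lemma zexpg1 a : zexpg a 1 = a. Proof. exact: expg1. Qed.

Lemma zexpgV a m : zexpg a^-1%g m = (zexpg a m)^-1%g.
Proof. by case: m => n /=; rewrite expVgn. Qed.

Lemma zexpg_conj a b m :
  zexpg (a * b * a^-1)%g m = (a * zexpg b m * a^-1)%g.
Proof.
by case: m => n; rewrite /zexpg expg_conj // !invgM invgK mulgA.
Qed.

End IntegerPowers.

Lemma run_zexpg (T : choiceType) (a : T) (s : seq (T * bool)) :
  all (fun l => l.1 == a) s -> exists m, word_val s = zexpg (gen a) m.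
Proof.
elim: s => [|[b e] s IHs] /=; first by exists 0%R; rewrite word_val_nil.
move=> /andP[/eqP-> /IHs[m Em]]; rewrite -cat1s word_val_cat Em.
exists ((if e then - 1 else 1) + m)%R; rewrite zexpgD; congr (_ * _).
by case: e; apply: val_inj.
Qed.

Lemma gen_zexpg_root (T : choiceType) (a : T) w m :
  m != 0%R -> zexpg w m = zexpg (gen a) m -> w = gen a.
Proof.
case: m => [[|n]|n] // _; first exact: gen_pow_root.
by move=> /invg_inj; apply: gen_pow_root.
Qed.

Lemma zexpg_eq1 (T : choiceType) (w : free T) m :
  m != 0%R -> zexpg w m = 1 -> w = 1.
Proof.
case: m => [[|n]|n] // _; first exact: pow_eq1.
by move/eqP; rewrite invg_eq1 => /eqP; apply: pow_eq1.
Qed.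

(** * Substitution in words *)

Lemma free_lift_map (T T' : choiceType) (f : T -> T') (h : T -> free T') w :
    injective f -> (forall a, h a = gen (f a)) ->
  fword (free_lift h w) = [seq (f l.1, l.2) | l <- fword w].
Proof.
move=> f_inj Eh; pose fl (l : T * bool) := (f l.1, l.2).
have fl_inj : injective fl by move=> [? ?] [? ?] [/f_inj-> ->].
rewrite -{1}[w]word_valK hom_word_val; last exact: gmulfM.
rewrite -[RHS]word_valE; last first.
  have := fword_reduced w; rewrite /reduced sorted_map.
  apply: sub_sorted => l m /=; apply: contra => /eqP E.
  by apply/eqP/fl_inj; rewrite /fl E.
congr fword; rewrite word_val_prod big_map; apply: eq_bigr => l _.
by rewrite /letter_val /= free_lift_gen Eh.
Qed.

Lemma ord2P (i : 'I_2) : i = ord0 \/ i = ord_max.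
Proof. by case: i => -[|[|[]]] // i; [left|right]; apply: val_inj. Qed.

Section Substitution.
Implicit Types (W V : F 2).

Lemma eval2M (G : groupType) (a b : G) :
  {morph (fun W => eval2 W a b) : u v / u * v}.
Proof. exact: gmulfM. Qed.

Lemma eval2_x (G : groupType) (a b : G) : eval2 x a b = a.
Proof. exact: free_lift_gen. Qed.

Lemma eval2_y (G : groupType) (a b : G) : eval2 y a b = b.
Proof. exact: free_lift_gen. Qed.

Lemma hom_eq2 (G : groupType) (f f' : F 2 -> G) :
    {morph f : u v / u * v} -> {morph f' : u v / u * v} ->
  f x = f' x -> f y = f' y -> f =1 f'.
Proof. by move=> fM f'M fx fy; apply: hom_eq => // a; case: (ord2P a) => ->. Qed.

Lemma hom_eval2 (G H : groupType) (f : G -> H) W a b :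
  {morph f : u v / u * v} -> f (eval2 W a b) = eval2 W (f a) (f b).
Proof.
move=> fM; have fM2 : {morph (fun u : F 2 => f (eval2 u a b)) : u v / u * v}.
  by move=> u v; rewrite eval2M fM.
apply: (hom_eq2 fM2 (@eval2M _ _ _)).
  by rewrite !eval2_x.
by rewrite !eval2_y.
Qed.

Lemma eval2_eval2 (G : groupType) W U V (a b : G) :
  eval2 (eval2 W U V) a b = eval2 W (eval2 U a b) (eval2 V a b).
Proof. exact/hom_eval2/eval2M. Qed.

Lemma eval2_id W : eval2 W x y = W.
Proof.
apply: (hom_eq2 (f := fun u => eval2 u x y) (f' := id)) => //.
- exact: eval2M.
- exact: eval2_x.
exact: eval2_y.
Qed.

Lemma tauM W V : {morph tau W V : u v / u * v}. Proof. exact: eval2M. Qed.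

End Substitution.

(** The set-theoretic Yang-Baxter equation for the map that sends [(a, b)] to
    [(W(a, b), V(a, b))], in all groups. *)
Definition yang_baxter (W V : F 2) := forall (G : groupType) (a b c : G),
  [/\ eval2 W a (eval2 W b c) = eval2 W (eval2 W a b) (eval2 W (eval2 V a b) c),
      eval2 V (eval2 W a b) (eval2 W (eval2 V a b) c)
        = eval2 W (eval2 V a (eval2 W b c)) (eval2 V b c)
    & eval2 V (eval2 V a b) c = eval2 V (eval2 V a (eval2 W b c)) (eval2 V b c)].

(** * Three letters *)

Definition x0 : 'I_3 := ord0.
Definition x1 : 'I_3 := @Ordinal 3 1 isT.
Definition x2 : 'I_3 := @Ordinal 3 2 isT.

Lemma ord3P (i : 'I_3) : [\/ i = x0, i = x1 | i = x2].
Proof.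
case: i => -[|[|[|[]]]] // i; [apply: Or31|apply: Or32|apply: Or33];
  exact: val_inj.
Qed.

Section Eval3.
Variables (G : groupType) (a b c : G).

Definition eval3 : F 3 -> G :=
  free_lift (fun k : 'I_3 => if k == x0 then a else if k == x1 then b else c).

Lemma eval3M : {morph eval3 : u v / u * v}. Proof. exact: gmulfM. Qed.
Lemma eval3_0 : eval3 (gen x0) = a. Proof. exact: free_lift_gen. Qed.
Lemma eval3_1 : eval3 (gen x1) = b. Proof. exact: free_lift_gen. Qed.
Lemma eval3_2 : eval3 (gen x2) = c. Proof. exact: free_lift_gen. Qed.

End Eval3.

Lemma eval2_word (a b : 'I_3) (W : F 2) : a != b ->
  fword (eval2 W (gen a) (gen b)) =
    [seq ((if l.1 == ord0 then a else b), l.2) | l <- fword W].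
Proof.
move=> nab; apply: (free_lift_map (f := fun k => if k == ord0 then a else b)).
  by move=> i j; case: (ord2P i) (ord2P j) => -> [] -> //= E;
     rewrite E eqxx in nab.
by move=> k; case: ifP.
Qed.

(** The witness is the image of [w] under the map that kills the last generator. *)
Lemma avoids_x2P (w : F 3) :
  avoids x2 (fword w) -> exists g, w = eval2 g (gen x0) (gen x1).
Proof.
move=> avw; exists (eval3 x y 1 w).
pose f u := eval2 (eval3 x y 1 u) (gen x0 : F 3) (gen x1).
have fM : {morph f : u v / u * v} by move=> u v; rewrite /f eval3M eval2M.
rewrite -[RHS]/(f w); apply: (hom_eq_in (f := id) (f' := f)) => // l.
rewrite /f => /(allP avw); case: (ord3P l.1) => -> //= _.
  by rewrite eval3_0 eval2_x.
by rewrite eval3_1 eval2_y.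
Qed.

Lemma avoids_x2 (g : F 2) : avoids x2 (fword (eval2 g (gen x0) (gen x1))).
Proof. by rewrite eval2_word // /avoids all_map; apply/allP => l _ /=; case: ifP. Qed.

Lemma eval2_x0x1_inj (g g' : F 2) :
  eval2 g (gen x0 : F 3) (gen x1) = eval2 g' (gen x0) (gen x1) -> g = g'.
Proof.
move/(congr1 (eval3 x y 1)); rewrite !(hom_eval2 _ _ _ (eval3M x y 1)).
by rewrite eval3_0 eval3_1 !eval2_id.
Qed.

(** * Fixed points of [tau] *)

Section FixedPoints.
Variables W V : F 2.
Hypothesis YB : yang_baxter W V.
Hypothesis tau_inj : injective (tau W V).

Let X : F 3 := gen x0.
Let Y : F 3 := gen x1.
Let Z : F 3 := gen x2.
Let t : F 3 -> F 3 := eval3 (eval2 W X Y) (eval2 V X Y) Z.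

Let tM : {morph t : u v / u * v}. Proof. exact: eval3M. Qed.

Let t_eval2 g : t (eval2 g X Y) = eval2 (tau W V g) X Y.
Proof. by rewrite hom_eval2 // /t eval3_0 eval3_1 eval2_eval2. Qed.

Let tZ : t Z = Z. Proof. exact: eval3_2. Qed.

Let t_avoids w : avoids x2 (fword w) -> avoids x2 (fword (t w)).
Proof. by move=> /avoids_x2P[g ->]; rewrite t_eval2 avoids_x2. Qed.

Let eval2_1 : eval2 (1 : F 2) X Y = 1.
Proof. exact: (hom1 (@eval2M _ X Y)). Qed.

Let t_inj w : avoids x2 (fword w) -> t w = 1 -> w = 1.
Proof.
move=> /avoids_x2P[g ->]; rewrite t_eval2 -eval2_1 => /eval2_x0x1_inj Eg.
by congr (eval2 _ _ _); apply: tau_inj; rewrite Eg (hom1 (@tauM W V)).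
Qed.

Let u := eval2 W X (eval2 W Y Z).

(* The first Yang-Baxter equation at [X, Y, Z]: its right-hand side is [t] applied
   to its left-hand side. *)
Let t_u : t u = u.
Proof.
have tX : t X = eval2 W X Y by exact: eval3_0.
have tY : t Y = eval2 V X Y by exact: eval3_1.
rewrite /u (hom_eval2 W X _ tM) (hom_eval2 W Y Z tM) tX tY tZ.
by have [<- _ _] := YB X Y Z.
Qed.

(** The extension [t] of [tau] fixes [u], preserves [Z], and restricts to the
    injective [tau] on words in [X, Y], so [hom_fixed_segment] applies. *)
Lemma tau_fixed_segment g p e e' q :
  fword u = p ++ (x2, e) :: fword (eval2 g X Y) ++ (x2, e') :: q ->
  tau W V g = g.
Proof.
move=> Eu; have := fword_reduced u; rewrite Eu => rs.
have /= := hom_fixed_segment tM tZ t_avoids t_inj rs (avoids_x2 g).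
rewrite -Eu !word_valK => /(_ t_u); rewrite t_eval2; exact: eval2_x0x1_inj.
Qed.

(** Since [t] maps words in [X, Y] to words in [X, Y], the reduced words of [u] and
    of [t u] are cut at the same letter [Z]. *)
Lemma tau_fixed_sides g h e : u = eval2 g X Y * word_val [:: (x2, e)] * eval2 h X Y ->
  tau W V g = g /\ tau W V h = h.
Proof.
move=> Eu; have := t_u; rewrite {}Eu !tM !t_eval2.
have -> : t (word_val [:: (x2, e)]) = word_val [:: (x2, e)].
  by apply: f_letter.
have fwordE g' h' : fword (eval2 g' X Y * word_val [:: (x2, e)] * eval2 h' X Y) =
    fword (eval2 g' X Y) ++ (x2, e) :: fword (eval2 h' X Y).
  have -> : eval2 g' X Y * word_val [:: (x2, e)] * eval2 h' X Y =
      word_val (fword (eval2 g' X Y) ++ [:: (x2, e)] ++ fword (eval2 h' X Y)).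
    by rewrite !word_val_cat !word_valK mulgA.
  rewrite [LHS]word_valE //.
  have avg := avoids_x2 g'; have avh := avoids_x2 h'.
  apply: reduced_glue => //.
    case/lastP: (fword _) avg (fword_reduced (eval2 g' X Y)) => [//|s l].
    rewrite /avoids all_rcons => /andP[l2 _] rs.
    rewrite -cats1 -catA; apply: reduced_glue; rewrite ?cats1 //.
    by rewrite /reduced /= andbT; apply: contra l2 => /eqP[->].
  rewrite cat1s reduced_cons fword_reduced andbT.
  by case: (fword _) avh => //= l s /andP[l2 _]; apply: contra_neq l2 => -[->].
move=> /(congr1 (@fword _)); rewrite !fwordE.
case/split_letter_inj; rewrite ?avoids_x2 // => Eg Eh.
by split; apply/eval2_x0x1_inj/val_inj.
Qed.

End FixedPoints.

(** * The shape of [W] *)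

Section Shape.
Variables W V : F 2.
Hypothesis YB : yang_baxter W V.
Hypothesis tau_inj : injective (tau W V).

Lemma tau_x : tau W V x = W. Proof. exact: eval2_x. Qed.
Lemma tau_y : tau W V y = V. Proof. exact: eval2_y. Qed.

Lemma eval2_zexpg (G : groupType) (a b : G) (g : F 2) m :
  eval2 (zexpg g m) a b = zexpg (eval2 g a b) m.
Proof. exact: (hom_zexpg (@eval2M _ a b)). Qed.

Lemma tau_zexpg g m : tau W V (zexpg g m) = zexpg (tau W V g) m.
Proof. exact: eval2_zexpg. Qed.

(** With [V = y], the second Yang-Baxter equation reads [tau W = W], while
    [tau x = W]. *)
Lemma V_eq_y : V = y -> W = x.
Proof.
move=> Vy; apply: tau_inj; rewrite tau_x; have [_ E _] := YB x x y.
by move: E; rewrite /tau Vy !eval2_y eval2_id => <-.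
Qed.

(** When [W] does not involve its second argument, the first equation reads
    [tau W = W], so [W = x]; the second one then reads [tau V = V]. *)
Lemma W_power m : W = zexpg x m -> W = x /\ V = y.
Proof.
move=> Wm; have Wx : W = x.
  apply: tau_inj; have [E _ _] := YB x y y.
  rewrite tau_x {2}Wm tau_zexpg tau_x.
  have EW (a b : F 2) : eval2 W a b = zexpg a m.
    by rewrite Wm eval2_zexpg eval2_x.
  by rewrite EW [RHS]EW eval2_id in E; rewrite -E.
split=> //; apply: tau_inj; rewrite tau_y; have [_ E _] := YB x y y.
by move: E; rewrite /tau Wx !eval2_x !eval2_id.
Qed.

Lemma avoids_run (i : 'I_2) (s : seq ('I_2 * bool)) :
  avoids i s -> all (fun l => l.1 == (if i == ord0 then ord_max else ord0)) s.
Proof.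
apply: sub_all => l; case: (ord2P l.1) => ->; case: (ord2P i) => -> //.
Qed.

(** A syllable [y^k] of [W] becomes [U^k] in [u = W(X, U)], where [U = W(Y, Z)], and
    it is bounded there by letters [X] or the ends of the word.  As [U^k] inherits
    an inner [Y]-syllable from [W], a nontrivial power of [Y] lies between two
    letters [Z] of [u]; so [tau] fixes a nontrivial power of [y]. *)
Lemma inner_V : inner ord_max ord0 (fword W) -> V = y.
Proof.
move=> iW; set X : F 3 := gen x0; set Y : F 3 := gen x1; set Z : F 3 := gen x2.
pose U := eval2 W Y Z.
have iU : inner x2 x1 (fword U).
  rewrite /U eval2_word //.
  exact: (inner_map (fun k => if k == ord0 then x1 else x2) iW).
have U1 : U != 1 by apply: contraPneq iU => -> [[|? ?] [? [? [? [? []]]]]].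
have : exists p s q, [/\ fword W = p ++ s ++ q, all (fun l => l.1 == ord0) p,
    s != [::], avoids ord0 s & q = [::] \/ exists e q', q = (ord0, e) :: q'].
  (* [s] is the first [y]-syllable of [W]. *)
  case: (split_letter (ord_max : 'I_2) (fword W)) => [avW|[p [e [s [avp EW]]]]].
    case: iW => p [e [r [e' [q [EW _ _]]]]].
    by move: avW; rewrite EW /avoids all_cat /= andbF.
  case: (split_letter (ord0 : 'I_2) s) => [avs|[r [e' [q [avr Es]]]]].
    exists p, ((ord_max, e) :: s), [::]; rewrite cats0.
    by split=> //; [exact: (avoids_run avp)|left].
  exists p, ((ord_max, e) :: r), ((ord0, e') :: q); rewrite EW Es.
  by split=> //; [exact: (avoids_run avp)|right; exists e', q].
move=> [p [s [q [EW xp s0 avs Eq]]]].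
have rs : reduced (p ++ s ++ q) by rewrite -EW fword_reduced.
have avP w : avoids ord0 (fword w) -> exists m, w = zexpg y m.
  by move=> /avoids_run/run_zexpg; rewrite word_valK.
have [p' [q' Eu]] : exists p' q', fword (eval2 W X U) =
    p' ++ fword (eval2 (word_val s) X U) ++ q'.
  rewrite -{1}[W]word_valK EW.
  apply: (@hom_first_segment _ _ ord0 x0 (fun w => eval2 w X U)) => //.
  - exact: eval2M.
  - exact: eval2_x.
  - move=> w /avP[m ->]; rewrite eval2_zexpg eval2_y /U -eval2_zexpg.
    by rewrite eval2_word // /avoids all_map; apply/allP => l _ /=; case: ifP.
  move=> w /avP[m ->]; rewrite eval2_zexpg eval2_y.
  have [->//|m0 /(zexpg_eq1 m0) E] := eqVneq m 0%R.
  by rewrite E eqxx in U1.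
have rs1 := reduced_catl (reduced_catr rs).
have [|k Ek] := avP (word_val s); first by rewrite word_valE.
have k0 : k != 0%R.
  apply: contra_neq s0 => k0; rewrite -(word_valE rs1) Ek k0; by [].
have [P [e [r [e' [Q [Eu' r0 yr]]]]]] : inner x2 x1 (fword (eval2 W X U)).
  by rewrite Eu Ek eval2_zexpg eval2_y; apply/inner_cat/inner_zexpg.
have rr : reduced r.
  have := fword_reduced (eval2 W X U); rewrite Eu' => /reduced_catr.
  by rewrite reduced_cons => /andP[_ /reduced_catl].
have [m Em] := run_zexpg yr.
have m0 : m != 0%R.
  by apply: contra_neq r0 => m0; rewrite -(word_valE rr) Em m0.
have Er : r = fword (eval2 (zexpg y m) X Y).
  by rewrite eval2_zexpg eval2_y -Em word_valE.
rewrite Er in Eu'; have := tau_fixed_segment YB tau_inj Eu'.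
by rewrite tau_zexpg tau_y => /(gen_zexpg_root m0).
Qed.

(** If [W] has an inner [x]-syllable then [inner_V] leads to the trivial pair, and
    so does [b = 0] by [W_power]. *)
Lemma W_shape : (W = x /\ V = y) \/
  exists a b a', W = zexpg x a * zexpg y b * zexpg x a' /\ b != 0%R.
Proof.
have [iW|niW] := pselect (inner ord_max ord0 (fword W)).
  by left; have Vy := inner_V iW; split=> //; apply: V_eq_y.
have [|p [q [r [EW xp yq xr]]]] := not_inner _ niW.
  by apply/allP => l _; case: (ord2P l.1) => ->.
have [a Ea] := run_zexpg xp; have [b Eb] := run_zexpg yq.
have [a' Ea'] := run_zexpg xr.
have EWp : W = zexpg x a * zexpg y b * zexpg x a'.
  by rewrite -[W]word_valK EW !word_val_cat Ea Eb Ea' mulgA.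
have [b0|b0] := eqVneq b 0%R; last by right; exists a, b, a'.
left; apply: (@W_power (a + a')%R).
by rewrite EWp b0 mulg1 zexpgD.
Qed.

End Shape.

(** * Exponent sums *)

Section ExponentSums.
Variable T : choiceType.
Implicit Types (a : T) (w : free T).

Let sgn (l : T * bool) : int := if l.2 then (- 1)%R else 1%R.

Definition expsum a w : int := (\sum_(l <- fword w) (if l.1 == a then sgn l else 0))%R.

Lemma expsumM a u v : expsum a (u * v) = (expsum a u + expsum a v)%R.
Proof.
have E (s : seq (T * bool)) : (\sum_(l <- reduce s) (if l.1 == a then sgn l else 0) =
    \sum_(l <- s) (if l.1 == a then sgn l else 0))%R.
  elim: s => // l s IHs; rewrite big_cons -IHs /=.
  case: (reduce s) => [|m r] /=; first by rewrite big_cons.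
  case: eqP => [->|_]; last by rewrite !big_cons.
  rewrite big_cons /sgn /=; case: l => b [] /=; case: (b == a) => //=; lia.
by rewrite /expsum E big_cat.
Qed.

Lemma expsum_gen a b : expsum a (gen b) = (b == a).
Proof. by rewrite /expsum big_seq1 /sgn /=; case: (b == a). Qed.

End ExponentSums.

Section Additive.
Local Open Scope ring_scope.

Lemma additive_zexpg (G : groupType) (f : G -> int) g m :
  {morph f : u v / (u * v)%g >-> u + v} -> f (zexpg g m) = m * f g.
Proof.
move=> fM; have f1 : f 1%g = 0 by have := fM 1%g 1%g; rewrite mulg1; lia.
elim/int_rect: m => [|n IHn|n IHn]; first by rewrite f1 mul0r.
  have -> : n.+1%:Z = n%:Z + 1 by lia.
  by rewrite zexpg_add1 fM IHn mulrDl mul1r.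
have -> : - n.+1%:Z = - n%:Z - 1 by lia.
have fV : f g^-1%g = - f g by have := fM g g^-1%g; rewrite mulgV; lia.
by rewrite zexpg_sub1 fM IHn fV mulrBl mul1r.
Qed.

Lemma additiveE (f : F 2 -> int) w : {morph f : u v / (u * v)%g >-> u + v} ->
  f w = expsum ord0 w * f x + expsum ord_max w * f y.
Proof.
move=> fM; have f1 : f 1%g = 0 by have := fM 1%g 1%g; rewrite mulg1; lia.
rewrite -{1}[w]word_valK word_val_prod (big_morph f fM f1) /expsum.
rewrite !mulr_suml -big_split; apply: eq_bigr => -[i e] _.
have fV u : f u^-1%g = - f u by have := fM u u^-1%g; rewrite mulgV; lia.
rewrite /letter_val /=; case: (ord2P i) => -> /=; case: e;
  by rewrite ?fV ?mulN1r ?mul1r mul0r ?addr0 ?add0r.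
Qed.

End Additive.

Section Constraints.
Variables (W V : F 2) (a b a' d c d' : int).
Hypothesis EW : W = zexpg x a * zexpg y b * zexpg x a'.
Hypothesis EV : V = zexpg y d * zexpg x c * zexpg y d'.
Local Open Scope ring_scope.

Lemma eval2_W (G : groupType) (g h : G) :
  eval2 W g h = (zexpg g a * zexpg h b * zexpg g a')%g.
Proof. by rewrite EW !eval2M !eval2_zexpg eval2_x eval2_y. Qed.

Lemma eval2_V (G : groupType) (g h : G) :
  eval2 V g h = (zexpg h d * zexpg g c * zexpg h d')%g.
Proof. by rewrite EV !eval2M !eval2_zexpg eval2_x eval2_y. Qed.

Lemma additive_W (G : groupType) (f : G -> int) g h :
    {morph f : u v / (u * v)%g >-> u + v} ->
  f (eval2 W g h) = (a + a') * f g + b * f h.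
Proof. by move=> fM; rewrite eval2_W !fM !additive_zexpg //; ring. Qed.

Lemma additive_V (G : groupType) (f : G -> int) g h :
    {morph f : u v / (u * v)%g >-> u + v} ->
  f (eval2 V g h) = c * f g + (d + d') * f h.
Proof. by move=> fM; rewrite eval2_V !fM !additive_zexpg //; ring. Qed.

Lemma expsum_W i : expsum i W = (a + a') * expsum i x + b * expsum i y.
Proof. by rewrite -{1}(eval2_id W) additive_W //; apply: expsumM. Qed.

Lemma expsum_V i : expsum i V = c * expsum i x + (d + d') * expsum i y.
Proof. by rewrite -{1}(eval2_id V) additive_V //; apply: expsumM. Qed.

(** The exponent sums of the first two generators in the first Yang-Baxter
    equation, and of the last generator in the third one. *)
Lemma linear_yang_baxter : yang_baxter W V ->
  [/\ (a + a') * b * (d + d') = 0, (a + a') * (1 - (a + a') - b * c) = 0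
    & (d + d') * (1 - (d + d') - b * c) = 0].
Proof.
move=> YB; have [E1 _ E3] := YB (F 3) (gen x0) (gen x1) (gen x2).
have fM i := @expsumM _ (i : 'I_3).
move: (congr1 (expsum x0) E1) (congr1 (expsum x1) E1) (congr1 (expsum x2) E3).
rewrite !(additive_W, additive_V, expsum_gen) //=; try exact: fM.
rewrite /= !(mulr0, mulr1, addr0, add0r) => H0 H1 H3; split; nia.
Qed.

(** The abelianization of [tau] is invertible over the integers, hence so is its
    determinant. *)
Lemma tau_det : (exists p, tau W V p = x) -> (exists q, tau W V q = y) ->
  exists k, k * ((a + a') * (d + d') - b * c) = 1.
Proof.
move=> [p Ep] [q Eq].
have E i u : expsum i (tau W V u) =
    expsum ord0 u * expsum i W + expsum ord_max u * expsum i V.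
  rewrite (@additiveE (fun u => expsum i (tau W V u))) ?tau_x ?tau_y //.
  by move=> v w; rewrite tauM expsumM.
have := E ord0 p; have := E ord_max p; have := E ord0 q; have := E ord_max q.
rewrite Ep Eq !expsum_W !expsum_V !expsum_gen /=.
set p0 := expsum ord0 p; set p1 := expsum ord_max p.
set q0 := expsum ord0 q; set q1 := expsum ord_max q.
rewrite !(mulr0, mulr1, addr0, add0r) => H1 H2 H3 H4.
exists (p0 * q1 - p1 * q0).
transitivity ((p0 * (a + a') + p1 * c) * (q0 * b + q1 * (d + d'))
            - (p0 * b + p1 * (d + d')) * (q0 * (a + a') + q1 * c)); first by ring.
by rewrite -H1 -H2 -H3 -H4; ring.
Qed.

End Constraints.

Lemma int_unit_factors (k b c : int) : (k * (b * c) = 1)%R ->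
  (b = 1 \/ b = - 1)%R /\ (c = 1 \/ c = - 1)%R.
Proof.
move=> E; have ub : (b \is a GRing.unit) by apply/unitrPr; exists (c * k)%R; rewrite -E; ring.
have uc : (c \is a GRing.unit) by apply/unitrPr; exists (k * b)%R; rewrite -E; ring.
by split; [case/orP: ub|case/orP: uc] => /eqP->; [left|right|left|right].
Qed.

Lemma zexpgN1 (G : groupType) (g : G) : zexpg g (- 1)%R = g^-1.
Proof. by []. Qed.

(** * Explicit fixed words *)

Section FixedWords.
Variables (W V : F 2) (a a' : int).
Hypothesis YB : yang_baxter W V.

(** The single letter [Z] of [u] separates [X^a Y^a] from [Y^a' X^a']. *)
Lemma fixed_pos : W = zexpg x a * y * zexpg x a' ->
  zexpg W a * zexpg V a = zexpg x a * zexpg y a /\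
  zexpg V a' * zexpg W a' = zexpg y a' * zexpg x a'.
Proof.
move=> EW; have /eval2_W E : W = zexpg x a * zexpg y 1 * zexpg x a' by rewrite zexpg1.
have [|] := tau_fixed_sides YB (g := zexpg x a * zexpg y a)
               (h := zexpg y a' * zexpg x a') (e := false).
- rewrite !E !zexpg1 !eval2M !eval2_zexpg !eval2_x !eval2_y !mulgA.
  by congr (_ * _ * _ * _ * _); apply: val_inj.
by rewrite !tauM !tau_zexpg tau_x tau_y.
Qed.

(** Here [W(Y, Z)] is inverted in [u], which exchanges and inverts the powers of
    [Y] around [Z]. *)
Lemma fixed_neg : W = zexpg x a * y^-1 * zexpg x a' ->
  zexpg W a * zexpg V (- a') = zexpg x a * zexpg y (- a') /\
  zexpg V (- a) * zexpg W a' = zexpg y (- a) * zexpg x a'.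
Proof.
move=> EW; have /eval2_W E : W = zexpg x a * zexpg y (- 1) * zexpg x a' by [].
have [|] := tau_fixed_sides YB (g := zexpg x a * zexpg y (- a'))
               (h := zexpg y (- a) * zexpg x a') (e := false).
- rewrite !E !zexpgN1 !invgM invgK -!zexpgN !eval2M !eval2_zexpg.
  rewrite !eval2_x !eval2_y !mulgA.
  by congr (_ * _ * _ * _ * _); apply: val_inj.
by rewrite !tauM !tau_zexpg tau_x tau_y.
Qed.

End FixedWords.

(** * First letters *)

Section Starts.
Variable T : choiceType.
Implicit Types (i j : T) (g h : free T).

Definition starts i g := omap fst (ohead (fword g)) = Some i.

Lemma starts_inj i j g : starts i g -> starts j g -> i = j.
Proof. by rewrite /starts => -> []. Qed.

Lemma fword_zexpg_gen i m : m != 0%R ->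
  exists e n, fword (zexpg (gen i) m) = nseq n.+1 (i, e).
Proof.
case: m => [[|n]|n] // _; [exists false|exists true]; exists n.
  exact: fword_gen_pow.
rewrite /zexpg fwordV fword_gen_pow /winv map_nseq.
by elim: n.+1 => // k IHk; rewrite rev_cons IHk; elim: k {IHk} => //= k ->.
Qed.

Lemma starts_zexpgM i m g : m != 0%R -> ~ starts i g ->
  starts i (zexpg (gen i) m * g).
Proof.
move=> /(fword_zexpg_gen i)[e [n Em]] ng; rewrite /starts fwordM Em //.
have := fword_reduced (zexpg (gen i) m); rewrite Em.
have rg : reduced ([:: (i, e)] ++ fword g).
  rewrite cat1s reduced_cons fword_reduced andbT.
  by apply: contra_not_neq ng; rewrite /starts => ->.
elim: n {Em} => // n IHn rn.
have rn1 : reduced (nseq n.+1 (i, e)) by apply: (reduced_catr (s := [:: (i, e)]) rn).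
have /= := reduced_glue (c := nseq n.+1 (i, e)) (s := [:: (i, e)]) _ rn (IHn rn1).
exact.
Qed.

Lemma starts_zexpg i j m : starts i (zexpg (gen j) m) -> i = j.
Proof.
have [->//|/(fword_zexpg_gen j)[e [n Em]]] := eqVneq m 0%R.
by rewrite /starts Em /= => -[].
Qed.

Lemma starts_pow i g n : starts i (g ^+ n.+1) <-> starts i g.
Proof.
have [->|g1] := eqVneq g 1; first by rewrite expg1n.
by rewrite /starts pow_head.
Qed.

End Starts.

Notation startx := (starts (ord0 : 'I_2)).
Notation starty := (starts (ord_max : 'I_2)).

Lemma startx_zexpgM m (g : F 2) : m != 0%R -> ~ startx g -> startx (zexpg x m * g).
Proof. exact: starts_zexpgM. Qed.

Lemma starty_zexpgM m (g : F 2) : m != 0%R -> ~ starty g -> starty (zexpg y m * g).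
Proof. exact: starts_zexpgM. Qed.

Lemma startxy (g : F 2) : startx g -> ~ starty g.
Proof. by move=> sx /(starts_inj sx). Qed.

Lemma startyx (g : F 2) : starty g -> ~ startx g.
Proof. by move=> sy /(starts_inj sy). Qed.

Lemma starty_yx m n : m != 0%R -> starty (zexpg y m * zexpg x n).
Proof. by move=> m0; apply: starty_zexpgM => // /starts_zexpg. Qed.

Lemma startx_xy m n : m != 0%R -> startx (zexpg x m * zexpg y n).
Proof. by move=> m0; apply: startx_zexpgM => // /starts_zexpg. Qed.

Lemma expg_swap (G : groupType) (g h : G) n : (g * h) ^+ n * g = g * (h * g) ^+ n.
Proof. by elim: n => [|n IHn]; rewrite ?mul1g ?mulg1 // !expgS -!mulgA IHn !mulgA. Qed.

(** Both sides start with [g] and end with [h]; cancelling them turns the equation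
    into one between words that start differently for suitable [g] and [h]. *)
Lemma expg_mul_shift (G : groupType) (g h : G) n :
  (g * h) ^+ n.+1 = g ^+ n.+1 * h ^+ n.+1 -> (h * g) ^+ n = g ^+ n * h ^+ n.
Proof.
move=> E; apply: (mulgI g); apply: (mulIg h).
by rewrite -expg_swap -mulgA -expgSr E mulgA -expgS -mulgA -expgSr.
Qed.

(** After the shift, for [n > 0] the base on the left starts with [x] while the
    right-hand side starts with [y]. *)
Lemma pow_yxx n : (y * x ^+ 2) ^+ n.+1 = y ^+ n.+1 * (x ^+ 2) ^+ n.+1 -> n = 0%N.
Proof.
move/expg_mul_shift; case: n => // n; rewrite -expgnA => E.
have : starty ((x ^+ 2 * y) ^+ n.+1).
  by rewrite E; apply: (@starty_yx n.+1 (2 * n.+1)%N).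
by move/starts_pow/startyx; case; apply: (@startx_xy (Posz 2) (Posz 1)).
Qed.

Lemma pow_xxy n : (x ^+ 2 * y) ^+ n.+1 = (x ^+ 2) ^+ n.+1 * y ^+ n.+1 -> n = 0%N.
Proof.
move/expg_mul_shift; case: n => // n; rewrite -expgnA => E.
have : startx ((y * x ^+ 2) ^+ n.+1).
  by rewrite E; apply: (@startx_xy (2 * n.+1)%N n.+1).
by move/starts_pow/startxy; case; apply: (@starty_yx (Posz 1) (Posz 2)).
Qed.

(** * Duality *)

Definition swap (w : F 2) : F 2 := eval2 w y x.

Lemma swapM : {morph swap : u v / u * v}. Proof. exact: eval2M. Qed.

Lemma eval2_swap (G : groupType) (w : F 2) (a b : G) :
  eval2 (swap w) a b = eval2 w b a.
Proof. by rewrite /swap eval2_eval2 eval2_x eval2_y. Qed.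

Lemma swapK : involutive swap.
Proof. by move=> w; rewrite {1}/swap eval2_swap eval2_id. Qed.

Lemma swap_zexpg w m : swap (zexpg w m) = zexpg (swap w) m.
Proof. exact: (hom_zexpg swapM). Qed.

Lemma swap_x : swap x = y. Proof. exact: eval2_x. Qed.
Lemma swap_y : swap y = x. Proof. exact: eval2_y. Qed.

Lemma swap_eval2 w u v : swap (eval2 w u v) = eval2 w (swap u) (swap v).
Proof. exact: (hom_eval2 _ _ _ swapM). Qed.

Lemma dualE W V : dual (W, V) = (swap V, swap W). Proof. by []. Qed.

Lemma dualK p : dual (dual p) = p.
Proof. by case: p => W V; rewrite !dualE !swapK. Qed.

Lemma tau_dual W V u : tau (swap V) (swap W) u = swap (tau W V (swap u)).
Proof. by rewrite /tau swap_eval2 eval2_swap. Qed.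

(** Reversing the triple [(a, b, c)] exchanges the outer two equations. *)
Lemma yang_baxter_dual W V : yang_baxter W V -> yang_baxter (swap V) (swap W).
Proof. by move=> YB G a b c; have [E1 E2 E3] := YB G c b a; rewrite !eval2_swap. Qed.

Lemma tau_dual_inj W V : injective (tau W V) -> injective (tau (swap V) (swap W)).
Proof.
move=> inj u v; rewrite !tau_dual => /(can_inj swapK)/inj; exact: (can_inj swapK).
Qed.

(** * The classification *)

Lemma is_inverse_gen (p q : F 2 * F 2) :
    eval2 p.1 q.1 q.2 = x -> eval2 p.2 q.1 q.2 = y ->
    eval2 q.1 p.1 p.2 = x -> eval2 q.2 p.1 p.2 = y -> is_inverse p q.
Proof.
have K (r s : F 2 * F 2) : eval2 r.1 s.1 s.2 = x -> eval2 r.2 s.1 s.2 = y ->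
    cancel (tau r.1 r.2) (tau s.1 s.2).
  move=> Ex Ey u; rewrite /tau eval2_eval2 Ex Ey; exact: eval2_id.
by move=> *; split; apply: K.
Qed.

Definition listed W V := exists p, wada_list p /\ derived_from p (W, V).

Lemma listed_dual W V : listed (swap V) (swap W) -> listed W V.
Proof.
move=> [p [lp dp]]; exists p; split=> //.
by rewrite -[(W, V)]dualK dualE; apply: derived_dual.
Qed.

Lemma listed_self W V : wada_list (W, V) -> listed W V.
Proof. by move=> lp; exists (W, V); split=> //; apply: derived_self. Qed.

Section FixedWordsDual.
Variables (W V : F 2) (d d' : int).
Hypothesis YB : yang_baxter W V.

Lemma fixed_neg_dual : V = zexpg y d * x^-1 * zexpg y d' ->
  zexpg V d * zexpg W (- d') = zexpg y d * zexpg x (- d').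
Proof.
move=> EV; have [|+ _] := fixed_neg (yang_baxter_dual YB) (a := d) (a' := d').
  by rewrite EV !swapM !swap_zexpg (homV swapM) swap_x swap_y.
by move/(congr1 swap); rewrite !swapM !swap_zexpg !swapK swap_x swap_y.
Qed.

End FixedWordsDual.

Lemma sqr_expg (G : groupType) (g : G) n : (g ^+ 2) ^+ n = g ^+ n * g ^+ n.
Proof. by rewrite -expgnA mulnC expgnA expg2. Qed.

Lemma unconj_left (G : groupType) (q u v : G) :
  q^-1 * (q^-1 * u * q) = v * q -> u = q * q * v.
Proof. by rewrite !mulgA => /mulIg <-; rewrite !mulgA mulgK mulgV mul1g. Qed.

Lemma unconj_right (G : groupType) (q u v : G) :
  q * u * q^-1 * q^-1 = q * v -> u = v * (q * q).
Proof. by rewrite -!mulgA => /mulgI <-; rewrite -!mulgA mulKg mulVg mulg1. Qed.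

Section Classification.
Variables (W V : F 2).
Hypothesis YB : yang_baxter W V.

(** For [c = -1], the exponent sum of [x] in the fixed word [y^d x^(-d')] of [tau]
    gives [d = d'], and the constraint on [d + d'] leaves [d = 0] or [d = 1]. *)
Lemma classify_y c d d' : W = y -> V = zexpg y d * zexpg x c * zexpg y d' ->
    (c = 1 \/ c = - 1)%R -> ((d + d') * (1 - (d + d') - c) = 0)%R ->
  listed W V.
Proof.
move=> EW + c1; case: c1 => -> EV HD.
  rewrite zexpg1 in EV; have Ed : d' = (- d)%R by nia.
  rewrite EW EV Ed -{1}[d]opprK; apply: listed_self; exact: wada_conj.
rewrite zexpgN1 in EV; have := fixed_neg_dual YB EV; rewrite EW.
move/(congr1 (expsum ord0)); rewrite !expsumM !(additive_zexpg _ _ (@expsumM _ _)).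
rewrite EV !expsumM !(additive_zexpg _ _ (@expsumM _ _)) -zexpgN1.
rewrite !(additive_zexpg _ _ (@expsumM _ _)) !expsum_gen /= => Hd.
have Ed : d' = d by lia.
have [d0|d1] : d = 0%R \/ d = 1%R by rewrite Ed in HD; nia.
  rewrite Ed d0 mul1g mulg1; apply: listed_self; exact: wada_y_Vx.
rewrite Ed d1 zexpg1; apply: listed_self; exact: wada_y_yVxy.
Qed.

Lemma zexpg_conjx a w m :
  zexpg (zexpg x a * w * zexpg x (- a)) m = zexpg x a * zexpg w m * zexpg x (- a).
Proof. by rewrite zexpgN zexpg_conj. Qed.

(** That [tau] fixes [x^a y^a] amounts to [V^a = x^a], so [V = x]. *)
Lemma classify_conj a d : a != 0%R -> W = zexpg x a * y * zexpg x (- a) ->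
  V = zexpg y d * x * zexpg y (- d) -> listed W V.
Proof.
move=> a0 EW EV.
have [+ _] := fixed_pos YB EW.
rewrite {1}EW zexpg_conjx => E.
have {}E : zexpg V a = zexpg x a.
  apply: (mulgI (zexpg x a * zexpg y a * zexpg x (- a))).
  by rewrite E zexpgN mulgVK.
have Vx : V = x by apply: (gen_zexpg_root a0 E).
apply: listed_dual; rewrite Vx EW !swapM !swap_zexpg swap_x swap_y.
by rewrite -{1}[a]opprK; apply: listed_self; apply: wada_conj.
Qed.

(** The fixed words give [W^d = y^d x^(2 d)].  For [d > 0] its right-hand side
    starts with [y], hence so does [W], and [a = 0]; for [d < 0] the same argument
    on inverses gives [a = 2].  In both cases [W^d = y^d x^(2 d)] holds only for
    [d = 1] or [d = -1], by [pow_yxx] and [pow_xxy].  For [d = 0] the words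
    fixed on the two sides of [Z] play the same role with [a] or [2 - a] as
    exponent, whichever is positive, and force [a = 1]. *)
Lemma classify_twisted a d :
  W = zexpg x a * y * zexpg x (2 - a) ->
  V = zexpg y d * x^-1 * zexpg y (- d) -> listed W V.
Proof.
move=> EW EV.
have [E1 E2] := fixed_pos YB EW.
have E3 : zexpg W d = zexpg y d * zexpg x (d + d).
  have := fixed_neg_dual YB EV; rewrite opprK => E.
  apply: (mulgI (zexpg V d)); rewrite E zexpgD.
  by rewrite EV zexpgN zexpg_conj zexpgV -!mulgA !mulKg.
have EWl : W = zexpg x a * (y * x ^+ 2) * zexpg x (- a).
  by rewrite EW zexpgD [in RHS]mulgA -!mulgA.
have EWr : W = zexpg x (- (2 - a)) * (x ^+ 2 * y) * zexpg x (- - (2 - a)).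
  rewrite opprK.
  have -> : x ^+ 2 = zexpg x 2 by [].
  by rewrite EW mulgA -zexpgD opprB subrK.
have startW k l : k != 0%R -> startx (zexpg x k * (y * zexpg x l)).
  by move=> k0; apply: startx_zexpgM => //; apply/startyx/(@starty_yx (Posz 1)).
case: d EV E3 => [[|n]|n] EV E3.
- rewrite mul1g mulg1 in EV.
  have [a_gt0|a_le0] := ltrP 0%R a; last first.
    have [n En] : exists n, (2 - a)%R = Posz n.+2 by exists (absz a); lia.
    suff /pow_xxy : (x ^+ 2 * y) ^+ n.+2 = (x ^+ 2) ^+ n.+2 * y ^+ n.+2 by [].
    rewrite sqr_expg; move: E2.
    by rewrite {1}EWr zexpg_conjx En opprK EV zexpgV zexpgN => /unconj_left.
  have [n En] : exists n, a = Posz n.+1 by exists (absz a).-1; lia.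
  have n0 : n = 0%N.
    apply: pow_yxx; rewrite sqr_expg; move: E1.
    by rewrite {1}EWl zexpg_conjx En EV zexpgV zexpgN => /unconj_right.
  rewrite EW En n0 EV; apply: listed_dual.
  rewrite !swapM !swap_zexpg (homV swapM) swap_x swap_y.
  apply: listed_self; exact: wada_Vy_yxy.
- have {}E3 : W ^+ n.+1 = y ^+ n.+1 * zexpg x (Posz n.+1 + Posz n.+1) := E3.
  have a0 : a = 0%R.
    apply/eqP/negPn/negP => /startW sx.
    have : starty (W ^+ n.+1) by rewrite E3; apply: (@starty_yx n.+1).
    by move/starts_pow/startyx; case; rewrite EW -mulgA.
  have {}EW : W = y * x ^+ 2 by rewrite EW a0 mul1g.
  have n0 : n = 0%N.
    by apply: pow_yxx; rewrite sqr_expg -EW E3 zexpgD.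
  rewrite EW EV n0; apply: listed_dual.
  rewrite !swapM !swap_zexpg (homV swapM) swap_x swap_y.
  apply: listed_self; exact: wada_xVyVx_xyy.
have E4 : W^-1 ^+ n.+1 = zexpg y (Negz n) * zexpg x (Negz n + Negz n).
  by rewrite expVgn -E3.
have a2 : a = Posz 2.
  apply/eqP/negPn/negP => a2; have : starty (W^-1 ^+ n.+1).
    by rewrite E4; apply: starty_yx.
  move/starts_pow/startyx; case.
  rewrite EW !invgM -!zexpgN; apply: startx_zexpgM; first by lia.
  exact/startyx/(@starty_yx (- 1)%R).
have {}EW : W = x ^+ 2 * y by rewrite EW a2 mulg1.
have n0 : n = 0%N.
  apply: pow_xxy; rewrite sqr_expg -EW.
  by apply: invg_inj; rewrite -expVgn E4 zexpgD invgM invgM.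
rewrite EW EV n0.
exists (x * y^-1 * x^-1, x * y ^+ 2); split; first exact: wada_xVyVx_xyy.
apply: derived_inverse; first exact: derived_self.
apply: is_inverse_gen => /=;
  rewrite !(eval2M, homV (@eval2M _ _ _), homX (@eval2M _ _ _), eval2_x, eval2_y);
  by apply/val_inj/eqP; vm_compute.
Qed.

End Classification.

(** If [W] is not [y], the exponent sums of the fixed words [x^a y^a] and
    [y^a' x^a'] give [d + d' = 0] and [a + a' + c = 1]. *)
Lemma classify_pos W V a a' c d d' : yang_baxter W V ->
    W = zexpg x a * zexpg y 1 * zexpg x a' ->
    V = zexpg y d * zexpg x c * zexpg y d' ->
    (c = 1 \/ c = - 1)%R ->
  listed W V.
Proof.
move=> YB EW EV c1; have [HA HAD HD] := linear_yang_baxter EW EV YB.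
have [a0|a_neq0] := boolP ((a == 0) && (a' == 0))%R.
  case/andP: a0 => /eqP a0 /eqP a'0; apply: (classify_y YB _ EV c1).
    by rewrite EW a0 a'0 mul1g mulg1 zexpg1.
  by move: HD; rewrite mul1r.
have EWi i := expsum_W EW i; have EVi i := expsum_V EV i.
rewrite zexpg1 in EW; have [F1 F2] := fixed_pos YB EW.
have [Ey Ex] : (d + d' = 0 /\ a + a' + c = 1)%R.
  have ev1 i := additive_zexpg _ _ (@expsumM _ (i : 'I_2)).
  have := congr1 (expsum ord0) F1; have := congr1 (expsum ord_max) F1.
  have := congr1 (expsum ord0) F2; have := congr1 (expsum ord_max) F2.
  rewrite !expsumM !ev1 !EWi !EVi !expsum_gen /= => H1 H2 H3 H4.
  have G1 : (a * (d + d') = 0)%R by lia.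
  have G2 : (a' * (d + d') = 0)%R by lia.
  have G3 : (a * (a + a' + c - 1) = 0)%R by lia.
  have G4 : (a' * (a + a' + c - 1) = 0)%R by lia.
  move: a_neq0; rewrite negb_and => /orP[] /mulfI nz; split.
  - by apply: nz; rewrite G1 mulr0.
  - by apply/eqP; rewrite -subr_eq0; apply/eqP/nz; rewrite G3 mulr0.
  - by apply: nz; rewrite G2 mulr0.
  - by apply/eqP; rewrite -subr_eq0; apply/eqP/nz; rewrite G4 mulr0.
have Ed : d' = (- d)%R by lia.
case: c1 => Ec; rewrite Ec Ed ?zexpg1 ?zexpgN1 in EV.
  have Ea : a' = (- a)%R by lia.
  by apply: (classify_conj YB (a := a) _ _ EV); rewrite ?EW ?Ea //; lia.
have Ea : a' = (2 - a)%R by lia.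
by apply: (classify_twisted YB (a := a) _ EV); rewrite EW Ea.
Qed.

(** The case [b = -1, c = 1] is dual to [b = 1, c = -1]; for [b = c = -1] the exponent
    sums of the fixed words already give [a = a' = d = d' = 0]. *)
Lemma classification W V : yang_baxter W V -> injective (tau W V) ->
    (exists p, tau W V p = x) -> (exists q, tau W V q = y) ->
  listed W V.
Proof.
move=> YB inj px qy.
have triv : W = x -> V = y -> listed W V.
  by move=> -> ->; apply: listed_self; exact: wada_trivial.
have [[Wx Vy]|[a [b [a' [EW b0]]]]] := W_shape YB inj; first exact: triv.
have [[Vx Wy]|[d [c [d' [EV c0]]]]] :=
  W_shape (yang_baxter_dual YB) (tau_dual_inj inj).
  by apply: triv; rewrite -[LHS]swapK ?Vx ?Wy ?swap_x ?swap_y.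
have {}EV : V = zexpg y d * zexpg x c * zexpg y d'.
  by rewrite -[LHS]swapK EV !swapM !swap_zexpg swap_x swap_y.
have [HAD HA HD] := linear_yang_baxter EW EV YB.
have {HAD}HAD : ((a + a') * (d + d') = 0)%R by apply: (mulIf b0); lia.
have [k] := tau_det EW EV px qy; rewrite HAD add0r => Ek.
have [b1 c1] : (b = 1 \/ b = - 1)%R /\ (c = 1 \/ c = - 1)%R.
  by apply: (@int_unit_factors (- k)%R); rewrite -Ek; ring.
case: b1 => Eb; first by rewrite Eb in EW; apply: (classify_pos YB EW EV c1).
rewrite Eb in EW HA HD; case: c1 => Ec; rewrite Ec in EV HA HD.
  apply: listed_dual.
  apply: (@classify_pos _ _ d d' (- 1)%R a a' (yang_baxter_dual YB)).
  - by rewrite EV !swapM !swap_zexpg swap_x swap_y.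
  - by rewrite EW !swapM !swap_zexpg swap_x swap_y.
  - by right.
have A0 : (a + a' = 0)%R by nia.
have D0 : (d + d' = 0)%R by nia.
have EWi i := expsum_W EW i; have EVi i := expsum_V EV i.
rewrite !zexpgN1 in EV EW.
have [F _] := fixed_neg YB EW; have F' := fixed_neg_dual YB EV.
have ev1 i := additive_zexpg _ _ (@expsumM _ (i : 'I_2)).
have := congr1 (expsum ord_max) F; have := congr1 (expsum ord0) F'.
rewrite !expsumM !ev1 !EWi !EVi !expsum_gen /= => H1 H2.
have [a0 a'0 d0 d'0] : [/\ a = 0, a' = 0, d = 0 & d' = 0]%R by split; lia.
rewrite EW EV a0 a'0 d0 d'0 !mul1g !mulg1.
apply: listed_self; exact: wada_Vy_Vx.
Qed.

(** * Representations of the braid group *)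

Lemma is_automorphismP W V :
  is_automorphism (tau W V) <-> exists q, is_inverse (W, V) q.
Proof.
split=> [[s Es]|[[W' V'] [K K']]]; last first.
  by exists (Aut (@tauM W V) K K').
exists (aut_inv s x, aut_inv s y).
have sM : {morph aut_inv s : u v / u * v} by exact: aut_invM.
have E : tau (aut_inv s x) (aut_inv s y) =1 aut_inv s.
  by apply: hom_eq2 => //; [exact: tauM|exact: tau_x|exact: tau_y].
by split=> u /=; rewrite E -Es ?autK ?autVK.
Qed.

Lemma is_inverse_sym p q : is_inverse p q -> is_inverse q p.
Proof. by case. Qed.

Lemma is_inverse_eval2 W V W' V' : is_inverse (W, V) (W', V') ->
  eval2 W W' V' = x /\ eval2 V W' V' = y.
Proof.
by move=> [K _]; have := K x; have := K y; rewrite /= tau_x tau_y.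
Qed.

Section LocalAction.
Variable n : nat.
Implicit Types (i j : 'I_n.-1).

Lemma lo_hi i : (hi i == lo i) = false.
Proof. by apply/negP => /eqP/(congr1 val) /=; lia. Qed.

Lemma hi_lo i j : j = i.+1 :> nat -> hi i = lo j.
Proof. by move=> Eij; apply: val_inj; rewrite /= Eij. Qed.

Variables W V : F 2.

Lemma tau__M i : {morph tau_ W V i : u v / u * v}. Proof. exact: gmulfM. Qed.

Lemma tau__lo i : tau_ W V i (x_ (lo i)) = eval2 W (x_ (lo i)) (x_ (hi i)).
Proof. by rewrite /tau_ free_lift_gen eqxx. Qed.

Lemma tau__hi i : tau_ W V i (x_ (hi i)) = eval2 V (x_ (lo i)) (x_ (hi i)).
Proof. by rewrite /tau_ free_lift_gen lo_hi eqxx. Qed.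

Lemma tau__fix i k : k != lo i -> k != hi i -> tau_ W V i (x_ k) = x_ k.
Proof. by move=> /negbTE k_lo /negbTE k_hi; rewrite /tau_ free_lift_gen k_lo k_hi. Qed.

Lemma tau__eval2 i w u v :
  tau_ W V i (eval2 w u v) = eval2 w (tau_ W V i u) (tau_ W V i v).
Proof. exact/hom_eval2/tau__M. Qed.

End LocalAction.

Section Braiding.
Variables (n : nat) (W V : F 2) (i j : 'I_n.-1).
Hypothesis Eij : j = i.+1 :> nat.
Let a := x_ (lo i).
Let b := x_ (lo j).
Let c := x_ (hi j).
Let ti := tau_ W V i.
Let tj := tau_ W V j.

Let ti_a : ti a = eval2 W a b.
Proof. by rewrite /ti /a tau__lo (hi_lo Eij). Qed.
Let ti_b : ti b = eval2 V a b.
Proof. by rewrite /ti /b -(hi_lo Eij) tau__hi. Qed.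
Let ti_c : ti c = c.
Proof. by apply: tau__fix; apply/eqP => /(congr1 val) /=; lia. Qed.
Let tj_a : tj a = a.
Proof. by apply: tau__fix; apply/eqP => /(congr1 val) /=; lia. Qed.
Let tj_b : tj b = eval2 W b c. Proof. exact: tau__lo. Qed.
Let tj_c : tj c = eval2 V b c. Proof. exact: tau__hi. Qed.
Let ti_eval2 w u v : ti (eval2 w u v) = eval2 w (ti u) (ti v).
Proof. exact: tau__eval2. Qed.
Let tj_eval2 w u v : tj (eval2 w u v) = eval2 w (tj u) (tj v).
Proof. exact: tau__eval2. Qed.

(** On three consecutive generators, the braid relation is the Yang-Baxter
    equation evaluated at these generators. *)
Lemma braid_relE :
  [/\ (ti (tj (ti a)) = tj (ti (tj a))) =
        (eval2 W (eval2 W a b) (eval2 W (eval2 V a b) c) = eval2 W a (eval2 W b c)),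
      (ti (tj (ti b)) = tj (ti (tj b))) =
        (eval2 V (eval2 W a b) (eval2 W (eval2 V a b) c)
         = eval2 W (eval2 V a (eval2 W b c)) (eval2 V b c))
    & (ti (tj (ti c)) = tj (ti (tj c))) =
        (eval2 V (eval2 V a b) c = eval2 V (eval2 V a (eval2 W b c)) (eval2 V b c))].
Proof.
by split; rewrite !(ti_a, ti_b, ti_c, tj_a, tj_b, tj_c, ti_eval2, tj_eval2).
Qed.

(** The generators of [F n] other than these three are fixed by both maps. *)
Lemma yang_baxter_braid : yang_baxter W V ->
  forall u, ti (tj (ti u)) = tj (ti (tj u)).
Proof.
move=> YB; have [E1 E2 E3] := YB (F n) a b c; have [B1 B2 B3] := braid_relE.
pose f u := ti (tj (ti u)); pose f' u := tj (ti (tj u)).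
have fM : {morph f : u v / u * v} by move=> u v; rewrite /f /ti /tj !tau__M.
have f'M : {morph f' : u v / u * v} by move=> u v; rewrite /f' /ti /tj !tau__M.
apply: (hom_eq fM f'M) => k; rewrite -/(x_ k).
have [->|ka] := eqVneq k (lo i); first by rewrite /f /f' B1.
have [->|kb] := eqVneq k (lo j); first by rewrite /f /f' B2.
have [->|kc] := eqVneq k (hi j); first by rewrite /f /f' B3.
have tik : ti (x_ k) = x_ k by apply: tau__fix => //; rewrite (hi_lo Eij).
have tjk : tj (x_ k) = x_ k by apply: tau__fix.
by rewrite /f /f' !(tik, tjk).
Qed.

End Braiding.

Lemma tau__far n (W V : F 2) (i j : 'I_n.-1) : (i.+1 < j)%N ->
  forall u, tau_ W V i (tau_ W V j u) = tau_ W V j (tau_ W V i u).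
Proof.
move=> lt_ij.
have il : tau_ W V i (x_ (lo j)) = x_ (lo j).
  by apply: tau__fix; apply/eqP => /(congr1 val) /=; lia.
have ih : tau_ W V i (x_ (hi j)) = x_ (hi j).
  by apply: tau__fix; apply/eqP => /(congr1 val) /=; lia.
have jl : tau_ W V j (x_ (lo i)) = x_ (lo i).
  by apply: tau__fix; apply/eqP => /(congr1 val) /=; lia.
have jh : tau_ W V j (x_ (hi i)) = x_ (hi i).
  by apply: tau__fix; apply/eqP => /(congr1 val) /=; lia.
apply: hom_eq => [u v|u v|k]; rewrite ?tau__M // -/(x_ k).
have [->|i1] := eqVneq k (lo i).
  by rewrite jl tau__lo tau__eval2 jl jh.
have [->|i2] := eqVneq k (hi i).
  by rewrite jh tau__hi tau__eval2 jl jh.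
have [->|j1] := eqVneq k (lo j).
  by rewrite il tau__lo tau__eval2 il ih.
have [->|j2] := eqVneq k (hi j).
  by rewrite ih tau__hi tau__eval2 il ih.
by rewrite (tau__fix _ _ j1 j2) (tau__fix _ _ i1 i2) (tau__fix _ _ j1 j2).
Qed.

Lemma tau__K n (W V W' V' : F 2) (i : 'I_n.-1) : is_inverse (W, V) (W', V') ->
  cancel (tau_ W V i) (tau_ W' V' i).
Proof.
move=> /is_inverse_eval2[EW EV].
apply: (hom_eq (f := fun u => tau_ W' V' i (tau_ W V i u)) (f' := id)) => //.
  by move=> u v; rewrite !tau__M.
move=> k; rewrite -/(x_ k).
have [->|k1] := eqVneq k (lo i).
  by rewrite tau__lo tau__eval2 tau__lo tau__hi -eval2_eval2 EW eval2_x.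
have [->|k2] := eqVneq k (hi i).
  by rewrite tau__hi tau__eval2 tau__lo tau__hi -eval2_eval2 EV eval2_y.
by rewrite !(tau__fix _ _ k1 k2).
Qed.

(** The value is computed on a representative; it is well defined because the
    relation [cong] is the smallest congruence containing the braid relations. *)
Lemma braid_lift n (G : groupType) (T : 'I_n.-1 -> G) :
    (forall u v, braid_rel u v -> free_lift T u = free_lift T v) ->
  exists rho : {multiplicative B n -> G}, forall i, rho (sigma i) = T i.
Proof.
move=> rel_T; pose f (q : B n) := free_lift T (repr q).
have cong_T u v : cong (@braid_rel n) u v -> free_lift T u = free_lift T v.
  elim=> //; first by move=> u1 u2 u3 _ -> _ ->.
  by move=> u1 u2 u3 u4 _ E _ E'; rewrite !free_liftM E E'.
have fM : {morph f : p q / p * q}.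
  move=> p q; rewrite /f -free_liftM; apply/cong_T/repr_cong.
pose f_mul := isMultiplicative.Build (B n) G f fM.
pose rho : {multiplicative B n -> G} := HB.pack f f_mul.
exists rho => i; rewrite -(free_lift_gen T i); exact/cong_T/repr_cong.
Qed.

Lemma pi_braidM n (u v : free 'I_n.-1) :
  \pi_(group_quot (@braid_rel n)) (u * v) =
  (\pi_(group_quot (@braid_rel n)) u : B n) * \pi_(group_quot (@braid_rel n)) v.
Proof. exact: pi_mul. Qed.

Lemma defines_wadaP W V :
  defines_wada W V <-> (exists q, is_inverse (W, V) q) /\ yang_baxter W V.
Proof.
split=> [[/is_automorphismP inv_WV rep]|[inv_WV YB]].
  split=> // G a b c; have [rho rhoE] := rep 3.
  pose i : 'I_3.-1 := ord0; pose j : 'I_3.-1 := ord_max.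
  have braid : sigma i * sigma j * sigma i = sigma j * sigma i * sigma j.
    rewrite /sigma -!pi_braidM; apply/eqP/group_quotP/cong_base.
    exact: braid_near.
  have {}braid u : tau_ W V i (tau_ W V j (tau_ W V i u)) =
      tau_ W V j (tau_ W V i (tau_ W V j u)).
    by rewrite -!rhoE; have /= := congr1 (fun s : aut (F 3) => s u)
      (congr1 rho braid); rewrite !gmulfM.
  have Eij : j = i.+1 :> nat by [].
  have [B1 B2 B3] := braid_relE W V Eij.
  have := braid (x_ (lo i)); have := braid (x_ (lo j)); have := braid (x_ (hi j)).
  rewrite B1 B2 B3.
  have -> : x_ (lo i) = gen x0 by congr gen; apply: val_inj.
  have -> : x_ (lo j) = gen x1 by congr gen; apply: val_inj.
  have -> : x_ (hi j) = gen x2 by congr gen; apply: val_inj.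
  move=> /(congr1 (eval3 a b c)) + /(congr1 (eval3 a b c)) + /(congr1 (eval3 a b c)).
  by rewrite !(hom_eval2 _ _ _ (eval3M a b c)) eval3_0 eval3_1 eval3_2.
split; first exact/is_automorphismP.
move=> n; have [[W' V'] WV'] := inv_WV.
pose T (i : 'I_n.-1) : aut (F n) :=
  Aut (@tau__M n W V i) (tau__K i WV') (tau__K i (is_inverse_sym WV')).
have [|rho rhoE] := @braid_lift n (aut (F n)) T.
  move=> _ _ [i j lt_ij|i j Eij]; rewrite !free_liftM !free_lift_gen;
    apply: aut_eqP => u.
  - exact: tau__far.
  - exact: yang_baxter_braid.
by exists rho => i u; rewrite rhoE.
Qed.

(** * Closure under the two symmetries *)

Section SetTheoretic.
Variables (G : groupType) (p : F 2 * F 2).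

Definition act12 (t : G * G * G) :=
  (eval2 p.1 t.1.1 t.1.2, eval2 p.2 t.1.1 t.1.2, t.2).

Definition act23 (t : G * G * G) :=
  (t.1.1, eval2 p.1 t.1.2 t.2, eval2 p.2 t.1.2 t.2).

End SetTheoretic.

(** In terms of the actions on triples the equation becomes an identity between
    compositions of maps, which can be inverted. *)
Lemma yang_baxter_act p : yang_baxter p.1 p.2 <->
  forall (G : groupType) (t : G * G * G),
    act12 p (act23 p (act12 p t)) = act23 p (act12 p (act23 p t)).
Proof.
split=> [YB G [[a b] c]|YB G a b c].
  by have [E1 E2 E3] := YB G a b c; rewrite /act12 /act23 /= -E1 E2 -E3.
by have [-> -> ->] := YB G (a, b, c).
Qed.

Lemma act12K (G : groupType) p q : is_inverse p q ->
  cancel (@act12 G p) (@act12 G q).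
Proof.
case: p q => W V [W' V'] /is_inverse_sym/is_inverse_eval2[EW EV] [[a b] c].
by rewrite /act12 /= -!eval2_eval2 EW EV eval2_x eval2_y.
Qed.

Lemma act23K (G : groupType) p q : is_inverse p q ->
  cancel (@act23 G p) (@act23 G q).
Proof.
case: p q => W V [W' V'] /is_inverse_sym/is_inverse_eval2[EW EV] [[a b] c].
by rewrite /act23 /= -!eval2_eval2 EW EV eval2_x eval2_y.
Qed.

Lemma yang_baxter_inverse p q : is_inverse p q ->
  yang_baxter p.1 p.2 -> yang_baxter q.1 q.2.
Proof.
move=> pq; have qp := is_inverse_sym pq.
move=> /yang_baxter_act YB; apply/yang_baxter_act => G t.
apply: (can_inj (act12K pq)); apply: (can_inj (act23K pq)).
apply: (can_inj (act12K pq)); rewrite !(act12K qp, act23K qp).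
by rewrite YB !(act12K qp, act23K qp).
Qed.

Lemma is_inverse_dual p q : is_inverse p q -> is_inverse (dual p) (dual q).
Proof.
case: p q => W V [W' V'] [K K']; rewrite !dualE.
by split=> u; rewrite /= !tau_dual swapK ?[tau W' V' _]K ?[tau W V _]K' swapK.
Qed.

Definition wada p := (exists q, is_inverse p q) /\ yang_baxter p.1 p.2.

Lemma derived_wada p q : derived_from p q -> wada p -> wada q.
Proof.
move=> pq wp; elim: pq => // [[W V] _ [[r Vr] YB]|q1 r _ [_ YB] qr].
  by split; [exists (dual r); apply: is_inverse_dual|apply: yang_baxter_dual].
by split; [exists q1; apply: is_inverse_sym|apply: yang_baxter_inverse qr YB].
Qed.

(** * The seven types *)

Lemma eval2V (G : groupType) (W : F 2) (a b : G) :
  eval2 W^-1 a b = (eval2 W a b)^-1.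
Proof. exact: (homV (@eval2M _ a b)). Qed.

Lemma eval2X (G : groupType) (W : F 2) (a b : G) n :
  eval2 (W ^+ n) a b = eval2 W a b ^+ n.
Proof. exact: (homX (@eval2M _ a b)). Qed.

Definition eval2E := (eval2M, eval2V, eval2X, eval2_zexpg, eval2_x, eval2_y).

(** Right-associated words are put in reduced form by cancelling neighbours. *)
Ltac group_normalize :=
  rewrite ?expg2 ?(invgM, invgK) -?mulgA
    ?(mulKg, mulVKg, mulVg, mulgV, mulg1, mul1g).

Lemma wada_list_wada p : wada_list p -> wada p.
Proof.
case=> [||m||||]; split=> [|G a b c] /=.
- by exists (x, y); apply: is_inverse_gen; rewrite /= !eval2E.
- by rewrite !eval2E.
- by exists (y^-1, x); apply: is_inverse_gen; rewrite /= !eval2E ?invgK.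
- by rewrite !eval2E.
- exists (zexpg x m * y * zexpg x (- m)%R, x).
  by apply: is_inverse_gen; rewrite /= !eval2E // !zexpgN; group_normalize.
- rewrite !eval2E !zexpgN; split=> //.
  set q := zexpg c m.
  have -> k : zexpg (q^-1 * b * q) k = q^-1 * zexpg b k * q.
    by rewrite -{2 4}[q]invgK zexpg_conj.
  by group_normalize.
- exists (x * y^-1 * x, x).
  by apply: is_inverse_gen; rewrite /= !eval2E //; group_normalize.
- by rewrite !eval2E; split=> //; group_normalize.
- by exists (y^-1, x^-1); apply: is_inverse_gen; rewrite /= !eval2E invgK.
- by rewrite !eval2E.
- exists (x * y * x, x^-1).
  by apply: is_inverse_gen; rewrite /= !eval2E; group_normalize.
- by rewrite !eval2E; split; group_normalize.
- exists (x ^+ 2 * y, y^-1 * x^-1 * y).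
  by apply: is_inverse_gen; rewrite /= !eval2E; group_normalize.
- by rewrite !eval2E; split; group_normalize.
Qed.

Theorem corollary1p2 (W V : F 2) :
  defines_wada W V <->
  exists p : F 2 * F 2, wada_list p /\ derived_from p (W, V).
Proof.
split=> [/defines_wadaP[[q [K K']] YB]|[p [/wada_list_wada wp dp]]]; last first.
  exact/defines_wadaP/(derived_wada dp wp).
apply: classification => //; first exact: can_inj K.
  by exists (tau q.1 q.2 x).
by exists (tau q.1 q.2 y).
Qed.
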